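(* Let $n\ge3$, let $M\ge0$ be an integer, and let $f:\mathbb{R}^{n-1}\to\mathbb{R}$ be continuous, with the origin not in the closure of its support, and such that $$\int_{\mathbb{R}^{n-1}}\frac{|f(y')|\,dy'}{|y'|^{M+n-2}+1}<\infty.$$ Let $x\in\Pi_+$ and adopt the convention that $D_m=D$ for $m\le0$. Then each of the following is equal to $N_M[f](x)$ (in the items involving $\hat y$, $y\neq0$): (i) $\displaystyle\int_{\theta_0}^{\theta}D_{M-1}[f_{\hat y}](x(t))\,dt+N_M[f](x(\theta_0))$, for $0\le\theta_0\le\frac\pi2$; (ii) $\displaystyle\tan\theta\int_{r_0}^{|x|}D_{M-1}[f_{\hat y}](t\hat x)\,\frac{dt}{t}-\sec\theta\int_{r_0}^{|x|}D_{M-2}[f](t\hat x)\,dt+N_M[f](r_0\hat x)$, for $r_0\ge0$; (iii) $\displaystyle\frac1{x_n}\int_{t_i}^{y_i}D_{M-1}[f_{\hat e_i}](\breve x_i(t))\,dt-\frac1{x_n}\int_{t_i}^{y_i}D_{M-2}[f](\breve x_i(t))\,t\,dt+N_M[f](\breve x_i(t_i))$, for $t_i\in\mathbb{R}$, $1\le i\le n-1$; (iv) $\displaystyle\frac1{x_n}\int_{\rho}^{|y|}D_{M-1}[f_{\hat y}](t\hat y+x_n\hat e_n)\,dt-\frac1{x_n}\int_{\rho}^{|y|}D_{M-2}[f](t\hat y+x_n\hat e_n)\,t\,dt+N_M[f](\rho\hat y+x_n\hat e_n)$, for $\rho\ge0$; (v) $\displaystyle-\int_{t_n}^{x_n}D_{M-2}[f](\breve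 x_n(t))\,dt+N_M[f](\breve x_n(t_n))$, for $t_n\ge0$.
   Context: Half space: $\Pi_+=\{x\in\mathbb{R}^n: x_n>0\}$; $\hat e_i$ is the $i$-th unit coordinate vector. For $x$ in the closed half space let $y=(y_1,\dots,y_{n-1})\in\mathbb{R}^{n-1}$ be the projection of $x$ onto $\partial\Pi_+$ (identified with $\mathbb{R}^{n-1}$), so $x=\sum_{i=1}^{n-1}y_i\hat e_i+x_n\hat e_n$, and let $\theta\in[0,\pi/2]$ be the angle between $x$ and $\hat e_n$, so $x_n=|x|\cos\theta$, $|y|=|x|\sin\theta$. Carets denote unit vectors: $\hat x=x/|x|$, $\hat y=y/|y|$. For $y'\in\mathbb{R}^{n-1}$, $\theta'\in[0,\pi]$ is the angle between $y$ and $y'$ (with $\theta'=\pi/2$ if $y=0$ or $y'=0$). Kernels: $K(\lambda,x,y')=\left[|y'-y|^2+x_n^2\right]^{-\lambda}$, and for $|y'|>0$ $$K_M(\lambda,x,y')=K(\lambda,x,y')-\sum_{m=0}^{M-1}\frac{|x|^m}{|y'|^{m+2\lambda}}C_m^\lambda(\sin\theta\cos\theta'),\qquad K_0=K,$$ where $C_m^\lambda$ are the Gegenbauer polynomials: $(1-2tz+z^2)^{-\lambda}=\sum_{m\ge0}z^mC_m^\lambda(t)$. With $\omega_n=\pi^{n/2}/\Gamma(1+n/2)$ and $\alpha_n=2/(n\omega_n)$, $$D[f](x)=\alpha_nx_n\int_{\mathbb{R}^{n-1}}f(y')K\left(\tfrac n2,x,y'\right)dy',\qquad D_M[f](x)=\alpha_nx_n\int_{\mathbb{R}^{n-1}}f(y')K_M\left(\tfrac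 n2,x,y'\right)dy',$$ $$N_M[f](x)=\frac{\alpha_n}{n-2}\int_{\mathbb{R}^{n-1}}f(y')K_M\left(\tfrac{n-2}2,x,y'\right)dy'.$$ Further notation: for $z_1,z_2\in\mathbb{R}^{n-1}$, $f_{z_1}(z_2)=(z_1\cdot z_2)f(z_2)$. For $0\le s\le\pi/2$, $x(s)$ is $x$ with its polar angle $\theta$ replaced by $s$: $x(s)=|x|\sin s\,\hat y+|x|\cos s\,\hat e_n$. If $x=\sum_{j=1}^nx_j\hat e_j$ then $\breve x_i(t)=\sum_{j\ne i}x_j\hat e_j+t\hat e_i$ ($1\le i\le n$). *)

(* Defs.v *)
From HB Require Import structures.
From mathcomp Require Import all_boot all_order all_algebra.
From mathcomp Require Import all_classical all_reals all_analysis.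

Set Implicit Arguments.
Unset Strict Implicit.
Unset Printing Implicit Defensive.

Import Order.TTheory GRing.Theory Num.Theory.
Import numFieldNormedType.Exports.

Local Open Scope classical_set_scope.
Local Open Scope ring_scope.

(* Lebesgue measure on R^d, carried by the Borel space of d-tuples: the
   product of d copies of the one-dimensional Lebesgue measure. *)
Section lebesgue_tuple.
Variable R : realType.
Local Notation mR := (measurableTypeR R).

Definition tcons (d : nat) (p : mR * d.-tuple mR) : d.+1.-tuple mR :=
  [tuple of p.1 :: p.2].

Lemma measurable_tcons (d : nat) : measurable_fun setT (@tcons d).
Proof. exact: measurable_cons measurable_fst measurable_snd. Qed.

Section step.
Variables (d : nat) (mu : {sigma_finite_measure set (d.-tuple mR) -> \bar R}).

Definition lebesgue_cons : set (d.+1.-tuple mR) -> \bar R :=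
  pushforward (@lebesgue_measure R \x mu)%E (@tcons d).

Let lebesgue_cons0 : lebesgue_cons set0 = 0%E.
Proof. by rewrite /lebesgue_cons /pushforward preimage_set0 measure0. Qed.

Let mtcons A : measurable A -> measurable (@tcons d @^-1` A).
Proof. by move=> mA; rewrite -[X in measurable X]setTI; exact: measurable_tcons. Qed.

Let lebesgue_cons_ge0 A : (0 <= lebesgue_cons A)%E.
Proof. by rewrite /lebesgue_cons /pushforward; exact: measure_ge0. Qed.

Let lebesgue_cons_sigma_additive : semi_sigma_additive lebesgue_cons.
Proof.
move=> F mF tF mUF; rewrite /lebesgue_cons /pushforward preimage_bigcup.
apply: measure_semi_sigma_additive.
- by move=> k; exact: mtcons.
- apply/trivIsetP => /= i j _ _ ij; rewrite -preimage_setI.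
  by move/trivIsetP : tF => /(_ _ _ _ _ ij) ->//; rewrite preimage_set0.
- by rewrite -preimage_bigcup; exact: mtcons.
Qed.

HB.instance Definition _ := isMeasure.Build _ _ _ lebesgue_cons
  lebesgue_cons0 lebesgue_cons_ge0 lebesgue_cons_sigma_additive.

Let lebesgue_cons_sigma_finite : sigma_finite setT lebesgue_cons.
Proof.
have /sigma_finiteP[F [TF ndF Foo]] := sigma_finiteT (@lebesgue_measure R).
have /sigma_finiteP[G [TG ndG Goo]] := sigma_finiteT mu.
pose hd (t : d.+1.-tuple mR) : mR := tnth t ord0.
pose tl (t : d.+1.-tuple mR) : d.-tuple mR := [tuple of behead t].
exists (fun k => (hd @^-1` F k) `&` (tl @^-1` G k)).
  rewrite predeqE => t; split=> // _.
  have [n _ Fn] : (\bigcup_k F k) (hd t) by rewrite -TF.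
  have [k _ Gk] : (\bigcup_k G k) (tl t) by rewrite -TG.
  exists (maxn n k) => //; split.
  - by have /subsetPset/(_ _ Fn) := ndF _ _ (leq_maxl n k).
  - by have /subsetPset/(_ _ Gk) := ndG _ _ (leq_maxr n k).
move=> k; have [mF Fk] := Foo k; have [mG Gk] := Goo k; split.
  apply: measurableI; rewrite -[X in measurable X]setTI.
  - exact: measurable_tnth.
  - exact: measurable_behead.
rewrite /lebesgue_cons /pushforward.
rewrite (_ : _ @^-1` _ = F k `*` G k); last first.
  rewrite predeqE => -[a t] /=; have -> : tl (tcons (a, t)) = t by exact/val_inj.
  by have -> : hd (tcons (a, t)) = a by rewrite /hd (tnth_nth a).
by rewrite product_measure1E// lte_mul_pinfty// ge0_fin_numE.
Qed.

HB.instance Definition _ := Measure_isSigmaFinite.Build _ _ _ lebesgue_cons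
  lebesgue_cons_sigma_finite.

End step.

Fixpoint lebesgue_tuple (d : nat) :
    {sigma_finite_measure set (d.-tuple mR) -> \bar R} :=
  match d with
  | 0 => \d_[tuple]
  | d'.+1 => lebesgue_cons (lebesgue_tuple d')
  end.

End lebesgue_tuple.
Arguments lebesgue_tuple {R} d.

Lemma lebesgue_tuple_box (R : realType) (d : nat)
    (A : 'I_d -> set (measurableTypeR R)) : (forall i, measurable (A i)) ->
  lebesgue_tuple d [set t | forall i, A i (tnth t i)] =
  (\prod_(i < d) lebesgue_measure (A i))%E.
Proof.
elim: d A => [|d IH] A mA.
  by rewrite big_ord0 /= diracE mem_set//= => -[].
have mB : measurable [set t : d.-tuple (measurableTypeR R) |
    forall i, A (lift ord0 i) (tnth t i)].
  rewrite (_ : [set t | _] =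
      \bigcap_i (@tnth _ (measurableTypeR R) ^~ i @^-1` A (lift ord0 i))); last first.
    by rewrite predeqE => t; split => [h i _|h i]; [exact: h|exact: h i I].
  apply: fin_bigcap_measurable => [|i _]; first exact: finite_finset.
  by rewrite -[X in measurable X]setTI; exact: measurable_tnth.
rewrite big_ord_recl -(IH (fun i => A (lift ord0 i)))// -product_measure1E//.
rewrite /= /lebesgue_cons /pushforward; congr (product_measure1 _ _ _).
rewrite predeqE => -[a t] /=; split=> [h|[h0 h] i].
  split=> [|i]; first by have := h ord0; rewrite (tnth_nth a).
  by have := h (lift ord0 i); rewrite !(tnth_nth a).
have [j ->|->] := unliftP ord0 i; last by rewrite (tnth_nth a).
by have := h j; rewrite !(tnth_nth a).
Qed.

Section euclidean.
Variable R : realType.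
Implicit Types d : nat.

(* The library norm on 'rV[R]_d is the sup norm, hence an explicit Euclidean
   one. *)
Definition edot d (u v : 'rV[R]_d) : R := \sum_(i < d) u 0 i * v 0 i.

Definition enorm d (u : 'rV[R]_d) : R := Num.sqrt (edot u u).

Definition unitv d (u : 'rV[R]_d) : 'rV[R]_d := (enorm u)^-1 *: u.

(* Angle in [0, pi], set to pi/2 when one of the vectors is 0. *)
Definition eangle d (u v : 'rV[R]_d) : R :=
  if (u == 0) || (v == 0) then pi / 2
  else acos (edot u v / (enorm u * enorm v)).

Definition basisv d (i : 'I_d) : 'rV[R]_d := delta_mx 0 i.

(* R^n is 'rV[R]_d.+1 with d = n - 1; the last coordinate x_n has index
   ord_max, and the i-th coordinate of the boundary R^d has index
   lift ord_max i, which is i as a natural number. *)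
Definition lastc d (x : 'rV[R]_d.+1) : R := x 0 ord_max.

Definition bdry d (x : 'rV[R]_d.+1) : 'rV[R]_d :=
  \row_(i < d) x 0 (lift ord_max i).

(* the point (y, t) of R^d x R *)
Definition hpoint d (y : 'rV[R]_d) (t : R) : 'rV[R]_d.+1 :=
  \row_(j < d.+1) oapp (fun i => y 0 i) t (unlift ord_max j).

Definition polar d (x : 'rV[R]_d.+1) : R := eangle x (basisv ord_max).

Definition set_polar d (x : 'rV[R]_d.+1) (s : R) : 'rV[R]_d.+1 :=
  hpoint ((enorm x * sin s) *: unitv (bdry x)) (enorm x * cos s).

Definition set_coord d (x : 'rV[R]_d) (i : 'I_d) (t : R) : 'rV[R]_d :=
  \row_(j < d) (if j == i then t else x 0 j).

Definition weight d (z : 'rV[R]_d) (f : 'rV[R]_d -> R) : 'rV[R]_d -> R :=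
  fun y => edot z y * f y.

Definition rV_of_tuple d (t : d.-tuple (measurableTypeR R)) : 'rV[R]_d :=
  \row_(i < d) tnth t i.

Definition integral_Rd d (g : 'rV[R]_d -> R) : R :=
  \int[lebesgue_tuple d]_t g (rV_of_tuple t).

Definition oriented_integral (a b : R) (g : R -> R) : R :=
  if a <= b then \int[lebesgue_measure]_(t in `[a, b]) g t
  else - \int[lebesgue_measure]_(t in `[b, a]) g t.

End euclidean.
Arguments basisv {R d} i.

Section kernels.
Variable R : realType.
Implicit Types (d M : nat) (lam : R).

(* The coefficient of z^m in the power series of (1 - 2tz + z^2)^(-lam) at
   z = 0, read off as a Taylor coefficient. *)
Definition gegenbauer m lam (t : R) : R :=
  derive1n m (fun z : R => (1 - 2 * t * z + z ^+ 2) `^ (- lam)) 0 / m`!%:R.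

Definition gammaf (a : R) : R :=
  \int[lebesgue_measure]_(t in `]0, +oo[) (t `^ (a - 1) * expR (- t)).

Definition omega (n : nat) : R := pi `^ (n%:R / 2) / gammaf (1 + n%:R / 2).

Definition alpha (n : nat) : R := 2 / (n%:R * omega n).

(* The singular value, at y' = y and x_n = 0, is 0 `^ (- lam) = 0; it occurs at
   one point y' only. *)
Definition kerK d lam (x : 'rV[R]_d.+1) (y' : 'rV[R]_d) : R :=
  (enorm (y' - bdry x) ^+ 2 + lastc x ^+ 2) `^ (- lam).

(* Only meaningful for y' != 0. At x = 0 the polar angle is irrelevant, as only
   the constant term m = 0 of the sum survives. *)
Definition kerKM d M lam (x : 'rV[R]_d.+1) (y' : 'rV[R]_d) : R :=
  kerK lam x y' -
  \sum_(m < M) enorm x ^+ m / enorm y' `^ (m%:R + 2 * lam) *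
    gegenbauer m lam (sin (polar x) * cos (eangle (bdry x) y')).

Definition opD d (f : 'rV[R]_d -> R) (x : 'rV[R]_d.+1) : R :=
  alpha d.+1 * lastc x *
  integral_Rd (fun y' => f y' * kerK (d.+1%:R / 2) x y').

Definition opDM d M (f : 'rV[R]_d -> R) (x : 'rV[R]_d.+1) : R :=
  alpha d.+1 * lastc x *
  integral_Rd (fun y' => f y' * kerKM M (d.+1%:R / 2) x y').

(* D_m for integer m, with D_m = D for m <= 0 *)
Definition opDz d (m : int) (f : 'rV[R]_d -> R) (x : 'rV[R]_d.+1) : R :=
  if m <= 0 then opD f x else opDM `|m|%N f x.

Definition opNM d M (f : 'rV[R]_d -> R) (x : 'rV[R]_d.+1) : R :=
  alpha d.+1 / (d.+1%:R - 2) *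
  integral_Rd (fun y' => f y' * kerKM M ((d.+1%:R - 2) / 2) x y').

End kernels.

(* Main.v *)
Require Import Defs.
From mathcomp Require Import all_boot all_order all_algebra.
From mathcomp Require Import all_classical all_reals all_analysis.
From mathcomp Require Import measurable_realfun.
From mathcomp Require Import ring lra zify.
Import Order.TTheory GRing.Theory Num.Theory.
Import numFieldNormedType.Exports.
Local Open Scope classical_set_scope.
Local Open Scope ring_scope.

(** All five formulas are one statement: integrate the gradient of N_M[f] along
a path X of the closed half space and exchange the integrals.

For fixed y', write u = y.y', v = |x|^2 and a = |y'|^2. The kernel
K(lam, x, y') is (a - 2u + v)^(-lam), and the subtracted sum is the beginning
of its expansion in homogeneous polynomials of weighted degree m in (u, v),
where u counts once and v twice. Differentiation in u lowers the degree by one,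
differentiation in v by two, and both raise lam by one, so that
    d K_M(lam) = 2 lam K_(M-1)(lam+1) du - lam K_(M-2)(lam+1) dv
([is_derive_gegenbauer_hom], [is_derive_scalar_kernel]); a negative index means
that nothing is subtracted, which is the convention D_m = D for m <= 0. For
lam = (n-2)/2 the factor 2 lam is cancelled by the 1/(n-2) of N_M and
lam + 1 = n/2 is the exponent of D. Hence, if along X
    du = beta (w.y') dt   and   dv = 2 gamma dt
for a fixed w, the increment of N_M[f] is alpha_n times the integral of
    beta I[(w.y') f K_(M-1)] - gamma I[f K_(M-2)],
I denoting integration in y' ([path_formula]). The five items are
  - polar angle: w = haty, beta = x_n, gamma = 0;
  - dilation t hatx: w = haty, beta = sin theta, gamma = t;
  - the coordinate y_i, and the direction haty: w = e_i or haty, beta = 1,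
    gamma = t;
  - height: w = 0, gamma = t = x_n.

The exchange needs integrability on [a,b] x R^(n-1). Far away this is the decay
|K_M(lam, x, y')| <= C |y'|^(-M-2lam) ([scalar_kernel_bound]), which turns the
hypothesis on f into a dominating function. Near the path there are two
regimes. If the path keeps a positive distance from the support of f, the
kernel is bounded ([path_formula_separated]). Otherwise, for the polar angle and
the height, the path may end on the boundary. Then the derivative in t of
K((n-2)/2) has a constant sign for each y', so the integral in t of its
absolute value is the difference of the two end values, and these are locally
integrable in y' ([path_formula_monotone]). Local integrability of
|y' - y|^(-(n-2)) on R^(n-1) comes from bounding it by a product of powers
|y'_i - y_i|^(-p) with p < 1 ([kernel_locally_integrable]). *)

Set Implicit Arguments.
Unset Strict Implicit.
Unset Printing Implicit Defensive.

(** * Derivatives of pointwise operations *)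

Section PointwiseDerivatives.
Variable R : realType.
Implicit Types (f g : R -> R) (t df dg c : R).

Lemma is_derive_fun_add f g t df dg : is_derive t 1 f df -> is_derive t 1 g dg ->
  is_derive t 1 (fun s => f s + g s) (df + dg).
Proof. by move=> hf hg; exact: is_deriveD. Qed.

Lemma is_derive_fun_sub f g t df dg : is_derive t 1 f df -> is_derive t 1 g dg ->
  is_derive t 1 (fun s => f s - g s) (df - dg).
Proof. by move=> hf hg; exact: is_deriveB. Qed.

Lemma is_derive_fun_mul f g t df dg : is_derive t 1 f df -> is_derive t 1 g dg ->
  is_derive t 1 (fun s => f s * g s) (df * g t + f t * dg).
Proof.
move=> hf hg; apply: (is_derive_eq (is_deriveM hf hg)).
by rewrite /GRing.scale/= addrC [g t * _]mulrC.
Qed.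

Lemma is_derive_fun_scale c f t df : is_derive t 1 f df ->
  is_derive t 1 (fun s => c * f s) (c * df).
Proof. by move=> hf; exact: (is_deriveZ c hf). Qed.

Lemma is_derive_fun_sum n (h : 'I_n -> R -> R) t (dh : 'I_n -> R) :
  (forall i, is_derive t 1 (h i) (dh i)) ->
  is_derive t 1 (fun s => \sum_(i < n) h i s) (\sum_(i < n) dh i).
Proof.
move=> hh; have := is_derive_sum hh.
by rewrite (_ : \sum_(i < n) h i = fun s => \sum_(i < n) h i s)//;
  apply/funext => s; rewrite fct_sumE.
Qed.

Lemma is_derive_fun_powR f t df a : 0 < f t -> is_derive t 1 f df ->
  is_derive t 1 (fun s => f s `^ a) (a * f t `^ (a - 1) * df).
Proof.
move=> f0 hf.
exact: (is_derive1_comp (is_derive1_powR a f0 : is_derive (f t) 1 _ _) hf).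
Qed.

End PointwiseDerivatives.

(** * Homogeneous Gegenbauer polynomials *)

Section Gegenbauer.
Variable R : realType.
Implicit Types (m M : nat) (lam a t : R).

(** The convention that coefficients of negative index vanish. *)
Definition shift1 (F : nat -> R) m : R := if m is k.+1 then F k else 0.

(** The coefficient of z^m in (1 - 2uz + vz^2)^(-lam), which is
v^(m/2) C_m^lam(u / v^(1/2)). Having u and v as variables makes it a polynomial
without singularity at v = 0. The recursion, which raises lam, is the one that
differentiating the generating function in z gives. *)
Fixpoint gegenbauer_hom m lam (u v : R) : R :=
  if m is k.+1 then
    2 * lam / k.+1%:R *
    (u * gegenbauer_hom k (lam + 1) u v -
     v * (if k is j.+1 then gegenbauer_hom j (lam + 1) u v else 0))
  else 1.

Lemma gegenbauer_homS m lam u v : gegenbauer_hom m.+1 lam u v =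
  2 * lam / m.+1%:R * (u * gegenbauer_hom m (lam + 1) u v -
    v * shift1 (fun k => gegenbauer_hom k (lam + 1) u v) m).
Proof. by case: m. Qed.

Lemma shift1S F m : shift1 F m.+1 = F m. Proof. by []. Qed.

Lemma gegenbauer_hom_scale m lam r u v :
  gegenbauer_hom m lam (r * u) (r ^+ 2 * v) = r ^+ m * gegenbauer_hom m lam u v.
Proof.
suff: forall lam, gegenbauer_hom m lam (r * u) (r ^+ 2 * v) = r ^+ m * gegenbauer_hom m lam u v /\
   gegenbauer_hom m.+1 lam (r * u) (r ^+ 2 * v) = r ^+ m.+1 * gegenbauer_hom m.+1 lam u v
  by move=> /(_ lam)[].
elim: m => [|m IH] {}lam; first by split; rewrite /=; ring.
split; first exact: (IH lam).2.
by rewrite !(gegenbauer_homS m.+1) !shift1S (IH _).1 (IH _).2 !exprS; ring.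
Qed.

(** Chain rule: the partial derivatives are 2 lam H_(m-1)^(lam+1) in u and
- lam H_(m-2)^(lam+1) in v, as for the generating function. Both follow from
the recursion by a simultaneous induction on two consecutive degrees. *)
Lemma is_derive_gegenbauer_hom m lam (u v : R -> R) t du dv :
  is_derive t 1 u du -> is_derive t 1 v dv ->
  is_derive t 1 (fun t => gegenbauer_hom m lam (u t) (v t))
   (2 * lam * du * shift1 (fun k => gegenbauer_hom k (lam + 1) (u t) (v t)) m
    - lam * dv * shift1 (shift1 (fun k => gegenbauer_hom k (lam + 1) (u t) (v t))) m).
Proof.
move=> hu hv.
pose P m lam := is_derive t 1 (fun t => gegenbauer_hom m lam (u t) (v t))
   (2 * lam * du * shift1 (fun k => gegenbauer_hom k (lam + 1) (u t) (v t)) m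
    - lam * dv * shift1 (shift1 (fun k => gegenbauer_hom k (lam + 1) (u t) (v t))) m).
rewrite -/(P m lam).
suff: forall lam, P m lam /\ P m.+1 lam by move=> /(_ lam)[].
elim: m => [|m IH] {}lam.
  split; rewrite /P.
    by apply: (is_derive_eq (is_derive_cst _ _ _)); rewrite /shift1; ring.
  rewrite (_ : (fun _ => _) = (2 * lam) *: u); last first.
    by apply/funext => s /=; rewrite scalrfctE/= /GRing.scale/=; lra.
  by apply: is_derive_eq; rewrite /shift1 /= /GRing.scale/=; ring.
split; first exact: (IH lam).2.
rewrite /P.
have [h1 h2] := IH (lam + 1).
have aux c (F G : R -> R) dF dG : is_derive t 1 F dF -> is_derive t 1 G dG ->
    is_derive t 1 (fun s => c * (u s * F s - v s * G s))
      (c * ((du * F t + u t * dF) - (dv * G t + v t * dG))).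
  move=> hF hG; apply: is_derive_fun_scale.
  by apply: is_derive_fun_sub; apply: is_derive_fun_mul.
rewrite (_ : (fun _ => _) = fun s => 2 * lam / m.+2%:R *
   (u s * gegenbauer_hom m.+1 (lam + 1) (u s) (v s) -
    v s * gegenbauer_hom m (lam + 1) (u s) (v s))); last first.
  by apply/funext => s; rewrite (gegenbauer_homS m.+1).
apply: (is_derive_eq (aux _ _ _ _ _ h2 h1)).
rewrite !shift1S.
have m2 : m.+2%:R != 0 :> R by rewrite pnatr_eq0.
apply: (mulfI m2).
case: m {IH} h1 h2 m2 => [|m] h1 h2 m2.
  by rewrite /=; field; rewrite ?pnatr_eq0.
have /eqP E1 : m.+2%:R * gegenbauer_hom m.+2 (lam + 1) (u t) (v t) ==
   2 * (lam + 1) * (u t * gegenbauer_hom m.+1 (lam + 1 + 1) (u t) (v t) -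
     v t * gegenbauer_hom m (lam + 1 + 1) (u t) (v t)).
  rewrite (gegenbauer_homS m.+1) shift1S; apply/eqP; field; by rewrite ?pnatr_eq0.
have /eqP E2 : m.+1%:R * gegenbauer_hom m.+1 (lam + 1) (u t) (v t) ==
   2 * (lam + 1) * (u t * gegenbauer_hom m (lam + 1 + 1) (u t) (v t) -
     v t * shift1 (fun k => gegenbauer_hom k (lam + 1 + 1) (u t) (v t)) m).
  rewrite (gegenbauer_homS m); apply/eqP; field; by rewrite ?pnatr_eq0.
move: E1 E2.
rewrite !shift1S.
set g2 := gegenbauer_hom m.+2 _ _ _; set g1 := gegenbauer_hom m.+1 (lam + 1) _ _.
set h1' := gegenbauer_hom m.+1 _ _ _; set h0 := gegenbauer_hom m _ _ _; set hm := shift1 _ m.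
clearbody g2 g1 h1' h0 hm.
have -> : m.+3%:R = m.+2%:R + 1 :> R by rewrite -natr1.
move=> E1 E2.
have E2' : m.+2%:R * g1 = 2 * (lam + 1) * (u t * h0 - v t * hm) + g1.
  by rewrite -E2 -(natr1 m.+1) mulrDl mul1r.
rewrite (_ : (m.+2%:R + 1) * (_ - _) = 2 * lam * du * (m.+2%:R * g2 + g2)
  - lam * dv * (m.+2%:R * g1 + g1)); last by ring.
rewrite mulrA.
rewrite (_ : (m.+2%:R + 1) * (2 * lam / (m.+2%:R + 1)) = 2 * lam); last first.
  by rewrite mulrC divfK// natr1 pnatr_eq0.
rewrite E1 E2'.
ring.
Qed.

End Gegenbauer.

(** * Gegenbauer polynomials as Taylor coefficients *)

Section GegenbauerTaylor.
Variable R : realType.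

(** The constant comes from 1 - 2u + z^2 >= (1 - z)^2. *)
Lemma quarter_le_quadratic (u z : R) : `|u| <= z -> z <= 2^-1 ->
  4^-1 <= 1 - 2 * u + z ^+ 2.
Proof.
move=> uz z2; have uz' : u <= z := le_trans (ler_norm _) uz.
rewrite -subr_ge0 (_ : _ - _ = (2 * (z - u)) + (2^-1 - z) * (3 / 2 - z)); last by field.
by rewrite addr_ge0 ?mulr_ge0// ?subr_ge0//; lra.
Qed.

Implicit Types (m M : nat) (lam a t s z : R).

(** The iterated derivatives in z of (1 - 2sz + z^2)^(-lam), by the Leibniz rule
applied to its first derivative -2 lam (z - s) (1 - 2sz + z^2)^(-lam-1). *)
Fixpoint generating_deriv m lam s z : R :=
  if m is k.+1 then
    - 2 * lam * ((z - s) * generating_deriv k (lam + 1) s z +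
       k%:R * (if k is j.+1 then generating_deriv j (lam + 1) s z else 0))
  else (1 - 2 * s * z + z ^+ 2) `^ (- lam).

Arguments generating_deriv : simpl never.

Lemma generating_derivS m lam s z : generating_deriv m.+1 lam s z =
  - 2 * lam * ((z - s) * generating_deriv m (lam + 1) s z +
    m%:R * shift1 (fun j => generating_deriv j (lam + 1) s z) m).
Proof. by case: m. Qed.

Lemma is_derive_generating_deriv m lam s z : 0 < 1 - 2 * s * z + z ^+ 2 ->
  is_derive z 1 (generating_deriv m lam s) (generating_deriv m.+1 lam s z).
Proof.
move=> q0.
suff: forall lam, is_derive z 1 (generating_deriv m lam s) (generating_deriv m.+1 lam s z) /\
   is_derive z 1 (generating_deriv m.+1 lam s) (generating_deriv m.+2 lam s z) by move=> /(_ lam)[].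
have D0 lam' : is_derive z 1 (generating_deriv 0 lam' s) (generating_deriv 1 lam' s z).
  pose q (z : R) : R := 1 - 2 * s * z + z ^+ 2.
  have dq : is_derive z 1 q (2 * (z - s)).
    by apply: is_derive_eq; rewrite /GRing.scale/=; ring.
  have := is_derive1_comp (is_derive1_powR (- lam') q0 : is_derive (q z) 1 _ _) dq.
  move=> h; apply: (is_derive_eq h).
  rewrite generating_derivS /generating_deriv /GRing.scale /= mul0r addr0 -opprD -/(q z); ring.
elim: m => [|m IH] {}lam; split.
- exact: D0.
- rewrite (_ : generating_deriv 1 lam s = (- 2 * lam) *:
    ((fun z => z - s) * generating_deriv 0 (lam + 1) s)); last first.
    by apply/funext => x; rewrite generating_derivS/= mul0r addr0.
  have := D0 (lam + 1) => h0.
  apply: is_derive_eq.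
  by rewrite (generating_derivS 1) shift1S /GRing.scale/=; ring.
- exact: (IH lam).2.
have aux (F G : R -> R) a b c k : is_derive z 1 F a -> is_derive z 1 G b ->
    is_derive z 1 (fun x => c * ((x - s) * F x + k * G x))
      (c * ((z - s) * a + F z + k * b)).
  move=> hF hG.
  have hs : is_derive z 1 (fun x => x - s) (1 - 0).
    exact: is_derive_fun_sub (is_derive_id _ _) (is_derive_cst s _ _).
  apply: (is_derive_eq (is_derive_fun_scale c (is_derive_fun_add
    (is_derive_fun_mul hs hF) (is_derive_fun_scale k hG)))).
  ring.
have [h1 h2] := IH (lam + 1).
rewrite (_ : generating_deriv m.+2 lam s =
  fun x => - 2 * lam * ((x - s) * generating_deriv m.+1 (lam + 1) s x
   + m.+1%:R * generating_deriv m (lam + 1) s x)); last by apply/funext => x; rewrite generating_derivS.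
apply: (is_derive_eq (aux _ _ _ _ _ _ h2 h1)).
rewrite (generating_derivS m.+2) shift1S -(natr1 m.+1).
set A := generating_deriv m.+2 _ _ _; set B := generating_deriv m.+1 _ _ _.
ring.
Qed.

Lemma generating_deriv0 m lam s : generating_deriv m lam s 0 = m`!%:R * gegenbauer_hom m lam s 1.
Proof.
suff: forall lam, generating_deriv m lam s 0 = m`!%:R * gegenbauer_hom m lam s 1 /\
  generating_deriv m.+1 lam s 0 = m.+1`!%:R * gegenbauer_hom m.+1 lam s 1 by move=> /(_ lam)[].
elim: m => [|m IH] {}lam; split.
- by rewrite /generating_deriv /= mulr0 subr0 expr0n/= addr0 powR1 mulr1.
- by rewrite /generating_deriv /= mulr0 subr0 expr0n/= addr0 powR1 !sub0r (_ : 1`! = 1%N)// divr1; ring.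
- exact: (IH lam).2.
rewrite generating_derivS (gegenbauer_homS m.+1) !shift1S (IH _).1 (IH _).2 [m.+2`!]factS [m.+1`!]factS
  !natrM; field.
by rewrite -natrD pnatr_eq0.
Qed.

(** The explicit derivatives are only valid where 1 - 2sz + z^2 is positive, so the
two are compared on the disc |z| < 1/2, on which this holds for every
|s| <= 1. *)
Lemma gegenbauerE m lam s : `|s| <= 1 -> gegenbauer m lam s = gegenbauer_hom m lam s 1.
Proof.
move=> s1.
have q0 z : `|z| < 2^-1 -> 0 < 1 - 2 * s * z + z ^+ 2.
  move=> z2; apply: lt_le_trans (_ : 4^-1 <= _); first by rewrite invr_gt0.
  rewrite -mulrA -[z ^+ 2](real_normK (num_real z)); apply: quarter_le_quadratic; last exact: ltW.
  by rewrite normrM ler_piMl.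
have E z : `|z| < 2^-1 ->
    derive1n m (fun z : R => (1 - 2 * s * z + z ^+ 2) `^ (- lam)) z = generating_deriv m lam s z.
  elim: m z => [//|k IH] z hz.
  rewrite derive1nS derive1E.
  have [_ <-] := is_derive_generating_deriv k lam (q0 _ hz).
  apply: near_eq_derive.
  have : nbhs z [set w : R | `|w| < 2^-1].
    apply/nbhs_ballP; exists (2^-1 - `|z|) => /=; first by rewrite subr_gt0.
    move=> w; rewrite /ball/= distrC ltrBrDr => /(le_lt_trans _); apply.
    by rewrite -{1}(subrK z w) ler_normD.
  by apply: filterS => w /= hw; exact: IH.
by rewrite /gegenbauer E ?normr0 ?invr_gt0// generating_deriv0 mulrC mulKf.
Qed.

End GegenbauerTaylor.

(** * The modified kernels *)

Section Kernel.
Variable R : realType.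
Implicit Types (m M : nat) (lam a t u v z : R).

(** The homogeneous part of degree m of (a - 2u + v)^(-lam): the scaling of
[gegenbauer_hom] allows to write it without a quotient. *)
Definition expansion_term lam a u v m : R := a `^ (- (lam + m%:R)) * gegenbauer_hom m lam u (a * v).

(** K_M as a function of a = |y'|^2, u = y.y' and v = |x|^2. *)
Definition scalar_kernel M lam a u v : R :=
  (a - 2 * u + v) `^ (- lam) - \sum_(m < M) expansion_term lam a u v m.

Lemma scalar_kernel0 lam a u v : scalar_kernel 0 lam a u v = (a - 2 * u + v) `^ (- lam).
Proof. by rewrite /scalar_kernel big_ord0 subr0. Qed.

Lemma sum_shift1 (F : nat -> R) M : \sum_(m < M) shift1 F m = \sum_(m < M.-1) F m.
Proof.
case: M => [|M]; first by rewrite !big_ord0.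
by rewrite big_ord_recl /= add0r; apply: eq_bigr.
Qed.

Lemma is_derive_expansion_term lam a (u v : R -> R) t du dv m : 0 < a ->
  is_derive t 1 u du -> is_derive t 1 v dv ->
  is_derive t 1 (fun s => expansion_term lam a (u s) (v s) m)
   (2 * lam * du * shift1 (expansion_term (lam + 1) a (u t) (v t)) m
    - lam * dv * shift1 (shift1 (expansion_term (lam + 1) a (u t) (v t))) m).
Proof.
move=> a0 hu hv.
have h := is_derive_fun_scale (a `^ (- (lam + m%:R)))
  (is_derive_gegenbauer_hom m lam hu (is_derive_fun_scale a hv)).
apply: (is_derive_eq h).
case: m {h} => [|[|m]]; rewrite /shift1 /expansion_term.
- by rewrite /= !mulr0 subr0 mulr0.
- by rewrite !mulr0 !subr0 addr0; ring.
rewrite mulrBr; congr (_ - _).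
  rewrite (_ : lam + 1 + m.+1%:R = lam + m.+2%:R); last by rewrite -[m.+2%:R]natr1; ring.
  by ring.
have -> : a `^ (- (lam + 1 + m%:R)) = a `^ (- (lam + m.+2%:R)) * a.
  rewrite -{3}[a]powRr1 ?ltW// -powRD; last by rewrite (gt_eqF a0) implybT.
  by congr (_ `^ _); rewrite -[m.+2%:R]natr1 -[m.+1%:R]natr1; ring.
ring.
Qed.

(** The identity behind all five formulas. The truncated predecessors [M.-1] and
[M.-2] encode the convention that K_m = K for m <= 0. *)
Lemma is_derive_scalar_kernel M lam a (u v : R -> R) t du dv :
  0 < a -> 0 < a - 2 * u t + v t -> is_derive t 1 u du -> is_derive t 1 v dv ->
  is_derive t 1 (fun s => scalar_kernel M lam a (u s) (v s))
   (2 * lam * du * scalar_kernel M.-1 (lam + 1) a (u t) (v t)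
    - lam * dv * scalar_kernel M.-2 (lam + 1) a (u t) (v t)).
Proof.
move=> a0 q0 hu hv.
have hq : is_derive t 1 (fun s => a - 2 * u s + v s) (0 - 2 * du + dv).
  exact: (is_derive_fun_add (is_derive_fun_sub (is_derive_cst a _ _)
    (is_derive_fun_scale 2 hu)) hv).
have h := is_derive_fun_sub
  (@is_derive_fun_powR _ (fun s => a - 2 * u s + v s) t _ (- lam) q0 hq)
  (is_derive_fun_sum (fun m : 'I_M => is_derive_expansion_term lam m a0 hu hv)).
apply: (is_derive_eq h).
rewrite /scalar_kernel sumrB -!mulr_sumr !sum_shift1 -opprD.
ring.
Qed.

Lemma expansion_term_scale lam a u v m : 0 < a ->
  expansion_term lam a u v m = a `^ (- lam) * expansion_term lam 1 (u / a) (v / a) m.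
Proof.
move=> a0; rewrite /expansion_term powR1 !mul1r.
have -> : gegenbauer_hom m lam u (a * v) = a ^+ m * gegenbauer_hom m lam (u / a) (v / a).
  rewrite -gegenbauer_hom_scale; congr (gegenbauer_hom _ _ _ _); first by rewrite mulrC divfK ?gt_eqF.
  by rewrite expr2 -mulrA [a * (v / a)]mulrC divfK ?gt_eqF.
rewrite mulrA -powR_mulrn ?ltW// -powRD ?(gt_eqF a0) ?implybT//.
by rewrite opprD subrK.
Qed.

Lemma scalar_kernel_scale M lam a u v : 0 < a -> 0 <= a - 2 * u + v ->
  scalar_kernel M lam a u v = a `^ (- lam) * scalar_kernel M lam 1 (u / a) (v / a).
Proof.
move=> a0 q0; rewrite /scalar_kernel mulrBr mulr_sumr; congr (_ - _); last first.
  by apply: eq_bigr => m _; exact: expansion_term_scale.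
have an0 : a != 0 by rewrite gt_eqF.
have E : 1 - 2 * (u / a) + v / a = (a - 2 * u + v) / a by field.
by rewrite -powRM ?E ?(ltW a0) ?divr_ge0 ?(ltW a0)// [a * _]mulrC divfK.
Qed.

Lemma gegenbauer_hom_bounded m lam (U : R) : exists2 B : R, 0 <= B &
  forall u v, `|u| <= U -> `|v| <= U -> `|gegenbauer_hom m lam u v| <= B.
Proof.
suff: forall lam, exists2 B : R, 0 <= B & forall u v, `|u| <= U -> `|v| <= U ->
    `|gegenbauer_hom m lam u v| <= B /\ `|gegenbauer_hom m.+1 lam u v| <= B.
  by move=> /(_ lam)[B B0 h]; exists B => // u v hu hv; have [] := h u v hu hv.
elim: m => [|m IH] {}lam.
  exists (1 + `|2 * lam| * `|U|); first by rewrite addr_ge0 ?mulr_ge0.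
  move=> u v hu hv; rewrite gegenbauer_homS /= normr1 lerDl ?mulr_ge0//; split => //.
  rewrite divr1 mulr1 mulr0 subr0 normrM.
  apply: ler_wpDl => //; rewrite ler_wpM2l// (le_trans hu)//.
  exact: ler_norm.
have [B B0 h] := IH lam; have [B' B'0 h'] := IH (lam + 1).
exists (B + `|2 * lam / m.+2%:R| * (`|U| * B' + `|U| * B')).
  by rewrite addr_ge0// mulr_ge0// addr_ge0// mulr_ge0.
move=> u v hu hv; have [_ h1] := h u v hu hv; have [h2 h3] := h' u v hu hv; split.
  by rewrite (le_trans h1)// lerDl mulr_ge0// addr_ge0// mulr_ge0.
rewrite (gegenbauer_homS m.+1) shift1S normrM; apply: ler_wpDl => //.
rewrite ler_wpM2l// (le_trans (ler_normB _ _))// (normrM u) (normrM v) lerD//.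
  by rewrite ler_pM// (le_trans hu (ler_norm U)).
by rewrite ler_pM// (le_trans hv (ler_norm U)).
Qed.

(** Along t |-> (tu, t^2 v) the derivative of the remainder involves the
remainders of orders M - 1 and M - 2 with lam + 1, and the remainder vanishes at
t = 0. The mean value theorem therefore gains one power of z, by induction on
the order for all lam at once. *)
Lemma scalar_kernel_remainder M lam : 0 <= lam -> exists2 C : R, 0 <= C &
  forall u z, `|u| <= z -> z <= 2^-1 -> `|scalar_kernel M lam 1 u (z ^+ 2)| <= C * z ^+ M.
Proof.
suff: forall N lam, 0 <= lam -> (M <= N)%N -> exists2 C : R, 0 <= C &
  forall u z, `|u| <= z -> z <= 2^-1 -> `|scalar_kernel M lam 1 u (z ^+ 2)| <= C * z ^+ M.
  by move=> /(_ M lam) h lam0; exact: h.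
move=> {lam} N; elim: N M => [|N IH] M lam lam0.
  rewrite leqn0 => /eqP ->; exists (4^-1 `^ (- lam)); first exact: powR_ge0.
  move=> u z uz z2; rewrite scalar_kernel0 mulr1.
  have q := quarter_le_quadratic uz z2.
  have q0 : 0 < 1 - 2 * u + z ^+ 2 by apply: lt_le_trans q; rewrite invr_gt0.
  rewrite ger0_norm ?powR_ge0// !powRN lef_pV2 ?posrE ?powR_gt0 ?invr_gt0//.
  by rewrite ge0_ler_powR// nnegrE ?invr_ge0// ltW.
case: M => [_|M MN]; first exact: IH.
have lam10 : 0 <= lam + 1 by rewrite addr_ge0.
have [C1 C10 h1] := IH M _ lam10 MN.
have [C2 C20 h2] := IH M.-1 _ lam10 (leq_trans (leq_pred M) MN).
exists (2 * lam * (C1 + C2)); first by rewrite mulr_ge0 ?mulr_ge0 ?addr_ge0.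
move=> u z uz z2.
have z0 : 0 <= z := le_trans (normr_ge0 _) uz.
pose k t := scalar_kernel M.+1 lam 1 (t * u) (t ^+ 2 * z ^+ 2).
pose dk t := 2 * lam * u * scalar_kernel M (lam + 1) 1 (t * u) ((t * z) ^+ 2)
    - lam * (2 * t * z ^+ 2) * scalar_kernel M.-1 (lam + 1) 1 (t * u) ((t * z) ^+ 2).
have tb t : 0 <= t <= 1 -> `|t * u| <= t * z /\ t * z <= 2^-1.
  move=> /andP[t0 t1]; split; first by rewrite normrM (ger0_norm t0) ler_wpM2l.
  by rewrite (le_trans _ z2)// ler_piMl.
have dkP t : 0 <= t <= 1 -> is_derive t 1 k (dk t).
  move=> ht; have [h3 h4] := tb _ ht.
  have := @is_derive_scalar_kernel M.+1 lam 1 (fun t => t * u) (fun t => t ^+ 2 * z ^+ 2) t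
     u (2 * t * z ^+ 2) ltr01.
  rewrite /k /dk -exprMn; apply.
  - by apply: lt_le_trans (quarter_le_quadratic h3 h4); rewrite invr_gt0.
  - apply: (is_derive_eq (is_derive_fun_mul (is_derive_id _ _) (is_derive_cst u _ _))).
    by rewrite mul1r mulr0 addr0.
  - have hx : is_derive t 1 (fun t => t ^+ 2) (1 * t + t * 1).
      exact: is_derive_fun_mul (is_derive_id _ _) (is_derive_id _ _).
    apply: (is_derive_eq (is_derive_fun_mul hx (is_derive_cst (z ^+ 2) _ _))).
    by rewrite /=; ring.
have kc : {within `[0, 1], continuous k}.
  apply: derivable_within_continuous => t; rewrite in_itv/= => /dkP h.
  by have [] := h.
have [|c] := @MVT_segment R k dk 0 1 ler01 _ kc.
  by move=> t; rewrite in_itv/= => /andP[t0 t1]; apply: dkP; rewrite !ltW.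
rewrite in_itv/= => cb.
have k0 : k 0 = 0.
  rewrite /k /scalar_kernel !mul0r mulr0 subr0 expr0n/= mul0r addr0 powR1.
  rewrite big_ord_recl big1 ?addr0; last first.
    move=> i _; rewrite /expansion_term gegenbauer_homS mulr0 !mul0r subr0 !mulr0.
    by [].
  by rewrite /expansion_term powR1 mul1r subrr.
have -> : scalar_kernel M.+1 lam 1 u (z ^+ 2) = k 1 by rewrite /k !mul1r expr1n mul1r.
rewrite k0 !subr0 mulr1 => ->.
have [cu cz] := tb _ cb; move: cb => /andP[c0 c1].
rewrite /dk (le_trans (ler_normB _ _))//.
set k1 := scalar_kernel M _ _ _ _; set k2 := scalar_kernel M.-1 _ _ _ _.
have -> : `|2 * lam * u * k1| = 2 * lam * `|u| * `|k1|.
  by rewrite !normrM (ger0_norm lam0) (ger0_norm (ler0n R 2)).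
have -> : `|lam * (2 * c * z ^+ 2) * k2| = lam * (2 * c * z ^+ 2) * `|k2|.
  by rewrite normrM ger0_norm// !mulr_ge0 ?exprn_ge0.
have e1 : `|scalar_kernel M (lam + 1) 1 (c * u) ((c * z) ^+ 2)| <= C1 * z ^+ M.
  rewrite (le_trans (h1 _ _ cu cz))// ler_wpM2l// lerXn2r ?nnegrE ?mulr_ge0//.
  by rewrite ler_piMl.
have e2 : z * `|scalar_kernel M.-1 (lam + 1) 1 (c * u) ((c * z) ^+ 2)| <= C2 * z ^+ M.
  rewrite (le_trans (ler_wpM2l z0 (h2 _ _ cu cz)))//.
  rewrite mulrCA ler_wpM2l// (@le_trans _ _ (z * z ^+ M.-1))//.
    rewrite ler_wpM2l// lerXn2r ?nnegrE ?mulr_ge0//.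
    by rewrite ler_piMl.
  case: (M) => [|m /=]; last by rewrite exprS.
  by rewrite /= !expr0 mulr1; lra.
have l1 : 2 * lam * `|u| * `|scalar_kernel M (lam + 1) 1 (c * u) ((c * z) ^+ 2)| <=
    2 * lam * z * (C1 * z ^+ M).
  by rewrite ler_pM ?mulr_ge0// ler_wpM2l ?mulr_ge0.
have l2 : lam * (2 * c * z ^+ 2) * `|scalar_kernel M.-1 (lam + 1) 1 (c * u) ((c * z) ^+ 2)| <=
    2 * lam * z * (C2 * z ^+ M).
  rewrite (_ : _ * _ = 2 * lam * z *
    (c * (z * `|scalar_kernel M.-1 (lam + 1) 1 (c * u) ((c * z) ^+ 2)|))); last first.
    by rewrite -/k2; ring.
  rewrite ler_wpM2l ?mulr_ge0// (le_trans _ e2)// ler_piMl// mulr_ge0//.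
apply: le_trans (lerD l1 l2) _.
rewrite exprS le_eqVlt; apply/orP; left; apply/eqP; ring.
Qed.

End Kernel.

(** * Euclidean geometry of the half space *)

Section Euclid.
Variable R : realType.
Implicit Types d : nat.

Lemma edotC d (u v : 'rV[R]_d) : edot u v = edot v u.
Proof. by apply: eq_bigr => i _; rewrite mulrC. Qed.

Lemma edotDl d (u v w : 'rV[R]_d) : edot (u + v) w = edot u w + edot v w.
Proof. by rewrite -big_split; apply: eq_bigr => i _; rewrite mxE mulrDl. Qed.

Lemma edotZl d a (u w : 'rV[R]_d) : edot (a *: u) w = a * edot u w.
Proof. by rewrite mulr_sumr; apply: eq_bigr => i _; rewrite mxE mulrA. Qed.

Lemma edotBl d (u v w : 'rV[R]_d) : edot (u - v) w = edot u w - edot v w.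
Proof. by rewrite -scaleN1r edotDl edotZl mulN1r. Qed.

Lemma edotBr d (u v w : 'rV[R]_d) : edot w (u - v) = edot w u - edot w v.
Proof. by rewrite edotC edotBl !(edotC w). Qed.

Lemma edotDr d (u v w : 'rV[R]_d) : edot w (u + v) = edot w u + edot w v.
Proof. by rewrite edotC edotDl !(edotC w). Qed.

Lemma edotZr d a (u w : 'rV[R]_d) : edot w (a *: u) = a * edot w u.
Proof. by rewrite edotC edotZl edotC. Qed.

Lemma edot_ge0 d (u : 'rV[R]_d) : 0 <= edot u u.
Proof. by apply: sumr_ge0 => i _; rewrite -expr2 sqr_ge0. Qed.

Lemma edot_eq0 d (u : 'rV[R]_d) : (edot u u == 0) = (u == 0).
Proof.
apply/eqP/eqP => [/eqP|->]; last by rewrite /edot big1// => i _; rewrite mxE mul0r.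
rewrite psumr_eq0; last by move=> i _; rewrite -expr2 sqr_ge0.
move=> /allP h; apply/rowP => i; rewrite mxE.
by have := h i (mem_index_enum _); rewrite -expr2 sqrf_eq0 => /eqP.
Qed.

Lemma enorm_ge0 d (u : 'rV[R]_d) : 0 <= enorm u.
Proof. exact: sqrtr_ge0. Qed.

Lemma sqr_enorm d (u : 'rV[R]_d) : enorm u ^+ 2 = edot u u.
Proof. by rewrite sqr_sqrtr// edot_ge0. Qed.

Lemma enorm_eq0 d (u : 'rV[R]_d) : (enorm u == 0) = (u == 0).
Proof. by rewrite -edot_eq0 -sqr_enorm sqrf_eq0. Qed.

Lemma enorm_gt0 d (u : 'rV[R]_d) : (0 < enorm u) = (u != 0).
Proof. by rewrite lt_def enorm_eq0 enorm_ge0 andbT. Qed.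

(** Expanding |(v.v) u - (u.v) v|^2 >= 0. *)
Lemma cauchy_schwarz d (u v : 'rV[R]_d) : `|edot u v| <= enorm u * enorm v.
Proof.
rewrite -(ger0_norm (mulr_ge0 (enorm_ge0 u) (enorm_ge0 v))).
rewrite -ler_sqr ?nnegrE// !real_normK ?num_real// exprMn !sqr_enorm.
have [->|v0] := eqVneq v 0.
  by rewrite /edot big1 ?expr0n ?mulr_ge0 ?sumr_ge0// => i _; rewrite ?mxE ?mulr0// -expr2 sqr_ge0.
have A0 : 0 < edot v v by rewrite lt_def edot_ge0 edot_eq0 v0.
have := edot_ge0 (edot v v *: u - edot u v *: v).
rewrite edotBl !edotBr !edotZl !edotZr (edotC v u).
set A := edot v v; set B := edot u v; set U := edot u u => h.
rewrite -subr_ge0 -(pmulr_rge0 _ A0) -/A.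
suff -> : A * (U * A - B ^+ 2) =
  A * (A * U) - A * (B * B) - (B * (A * B) - B * (B * A)) by [].
by ring.
Qed.

Lemma edot_bdry d (x : 'rV[R]_d.+1) :
  edot x x = edot (bdry x) (bdry x) + lastc x ^+ 2.
Proof.
rewrite {1}/edot (bigD1_ord ord_max)//= addrC -expr2; congr (_ + _).
by apply: eq_bigr => i _; rewrite !mxE.
Qed.

Lemma kernel_base d (x : 'rV[R]_d.+1) (y' : 'rV[R]_d) :
  enorm (y' - bdry x) ^+ 2 + lastc x ^+ 2 =
  edot y' y' - 2 * edot (bdry x) y' + edot x x.
Proof.
rewrite sqr_enorm edot_bdry edotBl !edotBr (edotC y' (bdry x)); ring.
Qed.

Lemma enorm_bdry_le d (x : 'rV[R]_d.+1) : enorm (bdry x) <= enorm x.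
Proof. by rewrite ler_wsqrtr// (edot_bdry x) lerDl sqr_ge0. Qed.

Lemma edot_basis d (x : 'rV[R]_d) i : edot x (basisv i) = x 0 i.
Proof.
rewrite /edot (bigD1 i)//= big1 ?addr0; first by rewrite mxE !eqxx mulr1.
by move=> j ji; rewrite mxE (negPf ji) andbF mulr0.
Qed.

Lemma enorm_basis d (i : 'I_d) : enorm (basisv i : 'rV[R]_d) = 1.
Proof. by rewrite /enorm edot_basis mxE !eqxx sqrtr1. Qed.

(** Multiplying by the norms makes the identity hold for zero vectors too, for
which the angle is a convention. *)
Lemma cos_eangle d (u v : 'rV[R]_d) :
  enorm u * enorm v * cos (eangle u v) = edot u v.
Proof.
rewrite /eangle; case: ifPn => [/orP[]/eqP->|].
- by rewrite cos_pihalf mulr0 edotC /edot big1// => i _; rewrite mxE mulr0.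
- by rewrite cos_pihalf mulr0 /edot big1// => i _; rewrite mxE mulr0.
rewrite negb_or -!enorm_gt0 => /andP[u0 v0].
have uv0 : 0 < enorm u * enorm v by rewrite mulr_gt0.
rewrite acosK; first by rewrite mulrC divfK// gt_eqF.
rewrite in_itv/= -ler_norml normrM normfV (gtr0_norm uv0) ler_pdivrMr// mul1r.
exact: cauchy_schwarz.
Qed.

Lemma cos_polar d (x : 'rV[R]_d.+1) : enorm x * cos (polar x) = lastc x.
Proof.
by have := cos_eangle x (basisv ord_max); rewrite enorm_basis mulr1 edot_basis.
Qed.

Lemma eangle_ge0 d (u v : 'rV[R]_d) : 0 <= eangle u v <= pi.
Proof.
rewrite /eangle; case: ifPn => _.
  by rewrite divr_ge0 ?pi_ge0//= ler_pdivrMr// ler_peMr ?pi_ge0// ler1n.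
have h : -1 <= edot u v / (enorm u * enorm v) <= 1.
  rewrite -ler_norml normrM normfV (ger0_norm (mulr_ge0 (enorm_ge0 u) (enorm_ge0 v))).
  have [->|uv0] := eqVneq (enorm u * enorm v) 0; first by rewrite invr0 mulr0 ler01.
  rewrite ler_pdivrMr ?mul1r ?cauchy_schwarz//.
  by rewrite lt_def uv0 mulr_ge0 ?enorm_ge0.
by rewrite acos_ge0// acos_lepi.
Qed.

Lemma sin_polar d (x : 'rV[R]_d.+1) : enorm x * sin (polar x) = enorm (bdry x).
Proof.
have s0 : 0 <= sin (polar x) by apply: sin_ge0_pi; exact: eangle_ge0.
apply: (pexpIrn (n := 2)) => //; rewrite ?nnegrE ?mulr_ge0 ?enorm_ge0//.
rewrite exprMn sin2cos2 mulrBr mulr1 -exprMn cos_polar !sqr_enorm edot_bdry.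
by rewrite addrK.
Qed.

(** The angles enter only through |x| |y'| sin theta cos theta' = y.y', and the
homogeneity of [gegenbauer_hom] absorbs the norms. *)
Lemma kerKM_space_kernel d M lam (x : 'rV[R]_d.+1) (y' : 'rV[R]_d) : y' != 0 ->
  kerKM M lam x y' = scalar_kernel M lam (edot y' y') (edot (bdry x) y') (edot x x).
Proof.
rewrite -enorm_gt0 => y0; rewrite /kerKM /scalar_kernel /kerK kernel_base.
congr (_ - _); apply: eq_bigr => m _.
set s := sin _ * cos _.
have s1 : `|s| <= 1.
  have h1 : `|sin (polar x)| <= 1 by rewrite ler_norml sin_geN1 sin_le1.
  have h2 : `|cos (eangle (bdry x) y')| <= 1 by rewrite ler_norml cos_geN1 cos_le1.
  by rewrite normrM -[leRHS]mulr1 ler_pM.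
rewrite gegenbauerE// /expansion_term -!sqr_enorm.
have -> : edot (bdry x) y' = (enorm x * enorm y') * s.
  rewrite -cos_eangle -sin_polar /s; ring.
have -> : enorm y' ^+ 2 * enorm x ^+ 2 = (enorm x * enorm y') ^+ 2 * 1 by ring.
rewrite gegenbauer_hom_scale mulrA; congr (_ * _).
rewrite exprMn mulrCA; congr (_ * _).
rewrite -!powR_mulrn ?ltW// -powRrM -powRD; last by rewrite (gt_eqF y0) implybT.
by rewrite -powRN; congr (_ `^ _); ring.
Qed.

(** * Decay of the modified kernels *)

Lemma sum_expansion_term_bounded M lam (U : R) : exists2 B : R, 0 <= B &
  forall u v, `|u| <= U -> `|v| <= U -> `|\sum_(m < M) expansion_term lam 1 u v m| <= B.
Proof.
elim: M => [|M [B B0 h]].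
  by exists 0 => // u v _ _; rewrite big_ord0 normr0.
have [C C0 h'] := gegenbauer_hom_bounded M lam U.
exists (B + C); first by rewrite addr_ge0.
move=> u v hu hv; rewrite big_ord_recr/= (le_trans (ler_normD _ _))// lerD ?h//.
by rewrite /expansion_term powR1 !mul1r h'.
Qed.

(** Here s, r and rho stand for |y'|, |x| and a bound of |x|. If s > 2 rho, then
r / s <= 1/2 and the remainder estimate applies. Otherwise s lies in the compact
interval from delta to 2 rho, where the subtracted terms are bounded, hence
bounded by a multiple of any power of s, and only K itself can be large. *)
Lemma scalar_kernel_bound M lam (delta rho : R) : 0 <= lam -> 0 < delta -> 0 <= rho ->
  exists2 C : R, 0 <= C & forall s r u : R, delta <= s -> 0 <= r <= rho ->
   `|u| <= r * s ->
   `|scalar_kernel M lam (s ^+ 2) u (r ^+ 2)| <=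
     (if s <= 2 * rho then (s ^+ 2 - 2 * u + r ^+ 2) `^ (- lam) else 0) +
     C * s `^ (- (M%:R + 2 * lam)).
Proof.
move=> lam0 d0 rho0.
have [C1 C10 h1] := scalar_kernel_remainder M lam0.
pose U := rho / delta + (rho / delta) ^+ 2.
have rd0 : 0 <= rho / delta by rewrite divr_ge0// ltW.
have [C2 C20 h2] := sum_expansion_term_bounded M lam U.
exists (C1 * rho ^+ M + C2 * (2 * rho) ^+ M).
  by rewrite addr_ge0// mulr_ge0// exprn_ge0// mulr_ge0.
move=> s r u ds /andP[r0 rrho] urs.
have s0 : 0 < s := lt_le_trans d0 ds.
have sn0 : s != 0 by rewrite gt_eqF.
have q0 : 0 <= s ^+ 2 - 2 * u + r ^+ 2.
  have := ler_norm u; have := sqr_ge0 (s - r); nra.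
have sM : (s ^+ 2) `^ (- lam) = s ^+ M * s `^ (- (M%:R + 2 * lam)).
  rewrite -!powR_mulrn ?ltW// -powRrM -powRD ?sn0 ?implybT//.
  by congr (_ `^ _); ring.
have e0 : 0 <= s `^ (- (M%:R + 2 * lam)) by exact: powR_ge0.
have [s2|s2] := leP s (2 * rho).
- rewrite /scalar_kernel (le_trans (ler_normB _ _))// ger0_norm ?powR_ge0// lerD2l.
  under eq_bigr do rewrite expansion_term_scale ?exprn_gt0//.
  rewrite -mulr_sumr normrM ger0_norm ?powR_ge0// sM.
  apply: (@le_trans _ _ (C2 * (2 * rho) ^+ M * s `^ (- (M%:R + 2 * lam)))).
    rewrite [leRHS]mulrAC -mulrAC; rewrite [leLHS]mulrAC ler_wpM2r//.
    rewrite mulrC ler_pM ?exprn_ge0// ?(ltW s0)//; last by rewrite lerXn2r ?nnegrE ?(ltW s0)// mulr_ge0.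
    have rs : r / s <= rho / delta.
      by rewrite ler_pM ?invr_ge0 ?(ltW s0)// lef_pV2.
    apply: h2.
      rewrite normrM normfV (ger0_norm (exprn_ge0 _ (ltW s0))).
      rewrite (@le_trans _ _ (r / s))//.
        by rewrite ler_pdivrMr ?exprn_gt0// expr2 mulrA divfK.
      by rewrite (le_trans rs)// lerDl exprn_ge0.
    rewrite -expr_div_n ger0_norm ?exprn_ge0 ?divr_ge0 ?(ltW s0)//.
    by rewrite (@le_trans _ _ ((rho / delta) ^+ 2)) ?lerDr// lerXn2r ?nnegrE// divr_ge0// ltW.
  by rewrite ler_wpM2r// lerDr mulr_ge0// exprn_ge0.
- rewrite add0r scalar_kernel_scale ?exprn_gt0// normrM ger0_norm ?powR_ge0// sM.
  rewrite -expr_div_n.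
  have rs : r / s <= 2^-1 by rewrite ler_pdivrMr//; lra.
  have us : `|u / s ^+ 2| <= r / s.
    rewrite normrM normfV (ger0_norm (exprn_ge0 _ (ltW s0))).
    by rewrite ler_pdivrMr ?exprn_gt0// expr2 mulrA divfK.
  apply: (@le_trans _ _ (C1 * rho ^+ M * s `^ (- (M%:R + 2 * lam)))); last first.
    by rewrite ler_wpM2r// lerDl mulr_ge0// exprn_ge0// mulr_ge0.
  rewrite [leLHS]mulrAC ler_wpM2r//.
  apply: (@le_trans _ _ (s ^+ M * (C1 * (r / s) ^+ M))).
    by rewrite ler_wpM2l ?exprn_ge0 ?(ltW s0)// h1.
  rewrite expr_div_n mulrCA ler_wpM2l// mulrC divfK ?expf_neq0//.
  by rewrite lerXn2r ?nnegrE.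
Qed.

End Euclid.

(** * Lebesgue measure on tuples *)

Section TupleMeasure.
Variable R : realType.
Local Notation mR := (measurableTypeR R).
Implicit Types d : nat.

Lemma measurable_box d (A : 'I_d -> set mR) : (forall i, measurable (A i)) ->
  measurable [set t : d.-tuple mR | forall i, A i (tnth t i)].
Proof.
move=> mA.
rewrite (_ : [set t | _] = \bigcap_i (@tnth _ mR ^~ i @^-1` A i)); last first.
  by rewrite predeqE => t; split => [h i _|h i]; [exact: h|exact: h i I].
apply: fin_bigcap_measurable => [|i _]; first exact: finite_finset.
by rewrite -[X in measurable X]setTI; exact: measurable_tnth.
Qed.

(** An open set is the union of the cubes with rational centres and radii 1/(m+1)
that it contains. *)
Lemma measurable_rV_open d (O : set 'rV[R]_d) : open O ->
  measurable (@rV_of_tuple R d @^-1` O).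
Proof.
move=> oO.
pose box (q : d.-tuple rat) (m : nat) : set (d.-tuple mR) :=
  [set t | forall i, ball (ratr (tnth q i) : R) m.+1%:R^-1 (tnth t i)].
have mbox q m : measurable (box q m).
  apply: (measurable_box (A := fun i => ball (ratr (tnth q i) : R) m.+1%:R^-1)) => i.
  exact: measurable_ball.
pose F (qm : d.-tuple rat * nat) : set (d.-tuple mR) :=
  if `[< box qm.1 qm.2 `<=` @rV_of_tuple R d @^-1` O >] then box qm.1 qm.2
  else set0.
rewrite (_ : _ @^-1` O = \bigcup_k F k).
  by apply: countable_bigcupT_measurable => // qm; rewrite /F; case: ifP.
rewrite predeqE => t; split; last first.
  by move=> [k _]; rewrite /F; case: ifPn => // /asboolP h; exact: h.
move=> Ot.
have /nbhs_ballP[e /= e0 he] : nbhs (rV_of_tuple t) O by exact: open_nbhs_nbhs.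
have [m hm] : exists m : nat, m.+1%:R^-1 < e / 2 :> R.
  have e20 : 0 < (e / 2)^-1 by rewrite invr_gt0 divr_gt0.
  exists (Num.truncn (e / 2)^-1).
  rewrite -[ltRHS]invrK ltf_pV2 ?posrE ?ltr0n//.
  exact: truncnS_gt.
have hq i : exists q : rat, ball (ratr q : R) m.+1%:R^-1 (tnth t i).
  have m0 : 0 < m.+1%:R^-1 :> R by rewrite invr_gt0.
  have [|q] := @rat_in_itvoo R (tnth t i - m.+1%:R^-1) (tnth t i + m.+1%:R^-1).
    by rewrite ltrD2l gtrN.
  rewrite in_itv/= => hq; exists q; by rewrite /ball/= ltr_distl.
have [qf hqf] := choice hq.
exists ([tuple qf i | i < d], m) => //.
have bt : box [tuple qf i | i < d] m t by move=> i; rewrite tnth_mktuple.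
rewrite /F /=; case: ifPn => // /asboolP[] t' ht'.
apply: he; rewrite /ball/= /mx_ball; split => // i j.
rewrite !mxE; have := bt j; have := ht' j; rewrite /ball/= tnth_mktuple => h1 h2.
rewrite -(subrK (ratr (qf j)) (tnth t j)) -addrA (le_lt_trans (ler_normD _ _))//.
rewrite (splitr e) ltrD// ?(lt_trans _ hm)//; first by rewrite distrC.
Qed.

Lemma measurable_continuous_rV d (f : 'rV[R]_d -> R) : continuous f ->
  measurable_fun setT (f \o @rV_of_tuple R d).
Proof.
move=> cf mD; apply: (measurability _ (RGenOpens.measurableE R)) => //.
move=> _ [_ [a [b ->] <-]]; rewrite setTI comp_preimage.
apply: measurable_rV_open; move/continuousP : cf; apply.
exact: interval_open.
Qed.

Lemma integral_lebesgue_tupleS d (F : d.+1.-tuple mR -> \bar R) :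
  measurable_fun setT F -> (forall t, 0 <= F t)%E ->
  (\int[lebesgue_tuple d.+1]_t F t =
   \int[@lebesgue_measure R]_s \int[lebesgue_tuple d]_t F (tcons (s, t)))%E.
Proof.
move=> mF F0.
have mFt : measurable_fun setT (F \o @tcons R d).
  exact: measurableT_comp mF (@measurable_tcons R d).
rewrite [LHS](_ : _ = \int[pushforward (@lebesgue_measure R \x lebesgue_tuple d)%E (@tcons R d)]_t F t)%E //.
rewrite ge0_integral_pushforward//; last exact: measurable_tcons.
rewrite preimage_setT fubini_tonelli1//.
by move=> x; exact: F0.
Qed.

Lemma integral_tuple_prod d (h : 'I_d -> mR -> R) :
  (forall i, measurable_fun setT (h i)) -> (forall i s, 0 <= h i s) ->
  (forall i, \int[@lebesgue_measure R]_s (h i s)%:E < +oo)%E ->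
  (\int[lebesgue_tuple d]_t (\prod_(i < d) h i (tnth t i))%:E < +oo)%E.
Proof.
elim: d h => [|d IH] h mh h0 hoo.
  rewrite integral_dirac//; first by rewrite diracE mem_set// mul1e big_ord0 ltry.
  by apply/measurable_EFinP; apply: measurable_prod => -[].
have mP : measurable_fun setT (fun t : d.+1.-tuple mR =>
    \prod_(i < d.+1) h i (tnth t i)).
  apply: measurable_prod => i _; apply: measurableT_comp => //.
  exact: measurable_tnth.
have mP' : measurable_fun setT (fun t : d.-tuple mR =>
    \prod_(i < d) h (lift ord0 i) (tnth t i)).
  apply: measurable_prod => i _; apply: measurableT_comp => //.
  exact: measurable_tnth.
rewrite integral_lebesgue_tupleS//; last 2 first.
- exact/measurable_EFinP.
- by move=> t; rewrite lee_fin prodr_ge0.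
have fin := IH (fun i => h (lift ord0 i)) (fun i => mh _) (fun i => h0 _) (fun i => hoo _).
have I0 : (0 <= \int[lebesgue_tuple d]_t (\prod_(i < d) h (lift ord0 i) (tnth t i))%:E)%E.
  by apply: integral_ge0 => t _; rewrite lee_fin prodr_ge0.
under eq_integral => s _.
  under eq_integral => t _.
    rewrite big_ord_recl (_ : tnth (tcons (s, t)) ord0 = s); last by rewrite (tnth_nth s).
    under eq_bigr => i _.
      rewrite (_ : tnth (tcons (s, t)) (lift ord0 i) = tnth t i); last first.
        by rewrite !(tnth_nth s).
      over.
    rewrite EFinM.
    over.
  rewrite ge0_integralZl//; last 3 first.
  - exact/measurable_EFinP.
  - by move=> t _; rewrite lee_fin prodr_ge0.
  - by rewrite lee_fin.
  over.
rewrite ge0_integralZr//.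
- have I1 : (0 <= \int[@lebesgue_measure R]_s (h ord0 s)%:E)%E.
    by apply: integral_ge0 => s _; rewrite lee_fin.
  by rewrite lte_mul_pinfty// ge0_fin_numE.
- exact/measurable_EFinP.
- by move=> s _; rewrite lee_fin.
Qed.

Lemma ae_coord_neq d (c : 'I_d -> R) :
  {ae lebesgue_tuple d, forall t, forall i, tnth t i != c i}.
Proof.
have h i : {ae lebesgue_tuple d, forall t, tnth t i != c i}.
  pose A j : set mR := if j == i then [set c i] else setT.
  have mA j : measurable (A j) by rewrite /A; case: ifP.
  exists [set t | forall j, A j (tnth t j)]; split.
  - exact: measurable_box.
  - rewrite lebesgue_tuple_box//.
    by rewrite (bigD1 i)//= {1}/A eqxx lebesgue_measure_set1 mul0e.
  - move=> t /= /negP; rewrite negbK => /eqP ti j.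
    by rewrite /A; case: eqP => // ->.
have [N [mN N0 hN]] := @filter_forall _ _ _ _
  (ae_filter_ringOfSetsType (lebesgue_tuple d)) h.
by exists N; split => // t ht; apply: hN => ht'; apply: ht => i; exact: ht'.
Qed.

End TupleMeasure.

(** * Integrals on the line *)

Section OneDim.
Variable R : realType.
Local Notation mR := (measurableTypeR R).
Local Notation leb := (@lebesgue_measure R).

(** The fundamental theorem of calculus with two-sided hypotheses at the end
points, which also covers a = b. *)
Lemma integral_is_derive (F f : R -> R) (a b : R) : a <= b ->
  (forall t, a <= t <= b -> is_derive t 1 F (f t)) ->
  (forall t, a <= t <= b -> {for t, continuous f}) ->
  (\int[leb]_(t in `[a, b]) (f t)%:E = (F b - F a)%:E)%E.
Proof.
rewrite le_eqVlt => /predU1P[<- _ _|ab dF cf].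
  by rewrite set_itv1 integral_set1 subrr.
have cF t : a <= t <= b -> {for t, continuous F}.
  move=> /dF[h _]; apply/differentiable_continuous.
  exact/derivable1_diffP.
have aab : a <= a <= b by rewrite lexx ltW.
have bab : a <= b <= b by rewrite lexx ltW.
rewrite EFinB; apply: continuous_FTC2 => //.
- apply: continuous_in_subspaceT => t; rewrite inE/= in_itv/= => h; exact: cf.
- split.
  + move=> t; rewrite in_itv/= => /andP[t1 t2].
    by have [] : is_derive t 1 F (f t) by apply: dF; rewrite !ltW.
  + apply: cvg_at_right_filter; exact: cF.
  + apply: cvg_at_left_filter; exact: cF.
- move=> t; rewrite in_itv/= => /andP[t1 t2].
  have [_ <-] : is_derive t 1 F (f t) by apply: dF; rewrite !ltW.
  by rewrite derive1E.
Qed.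

Lemma is_derive_continuous (F : R -> R) (t df : R) : is_derive t 1 F df ->
  {for t, continuous F}.
Proof. by move=> [h _]; apply/differentiable_continuous; exact/derivable1_diffP. Qed.

(** Used to approach the singularity of a nonnegative function. *)
Lemma integral_exhaustion d (T : measurableType d) (mu : {measure set T -> \bar R})
    (F : (set T)^nat) (f : T -> \bar R) (B : \bar R) :
  nondecreasing_seq F -> (forall n, measurable (F n)) ->
  (forall n, measurable_fun (F n) f) -> (forall n t, F n t -> 0 <= f t)%E ->
  (forall n, \int[mu]_(t in F n) f t <= B)%E ->
  (\int[mu]_(t in \bigcup_n F n) f t <= B)%E.
Proof.
move=> nF mF mf f0 h.
have /(_ mu) c := ge0_nondecreasing_set_cvg_integral nF mF mf f0.
rewrite -(cvg_lim _ c)//; apply: lime_le; first exact: cvgP c.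
exact: nearW.
Qed.

Lemma measurable_dist_powR (c p : R) : measurable_fun setT (fun s : mR => `|s - c| `^ p).
Proof.
apply: (measurableT_comp (measurable_powR p)).
apply: measurableT_comp; first exact: normr_measurable.
by apply: measurable_funB.
Qed.

Lemma powR_antideriv_le (p x y : R) : p < 1 ->
  (x `^ (1 - p) / (1 - p) - y `^ (1 - p) / (1 - p)) <= x `^ (1 - p) / (1 - p).
Proof. by move=> p1; rewrite gerBl divr_ge0 ?powR_ge0// subr_ge0 ltW. Qed.

Lemma integral_dist_powR_right (p c L e : R) : 0 < p < 1 -> 0 < e -> e <= L ->
  (\int[leb]_(s in `[(c + e)%R, (c + L)%R]) (`|s - c| `^ (- p))%:E
    <= (L `^ (1 - p) / (1 - p))%:E)%E.
Proof.
move=> /andP[p0 p1] e0 eL.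
have p10 : 1 - p != 0 by rewrite subr_eq0 gt_eqF.
have dsc (t : R) : is_derive t 1 (fun s : R => s - c) (1 - 0).
  exact: is_derive_fun_sub (is_derive_id _ _) (is_derive_cst c _ _).
rewrite (eq_integral (fun s : mR => ((s - c) `^ (- p))%:E)); last first.
  move=> s; rewrite inE/= in_itv/= => /andP[s1 _].
  by rewrite ger0_norm// subr_ge0 (le_trans _ s1)// lerDl ltW.
have -> : (\int[leb]_(s in `[(c + e)%R, (c + L)%R]) ((s - c) `^ (- p))%:E =
    ((1 - p)^-1 * (c + L - c) `^ (1 - p) - (1 - p)^-1 * (c + e - c) `^ (1 - p))%:E)%E.
  refine (@integral_is_derive (fun s : R => (1 - p)^-1 * (s - c) `^ (1 - p))
    (fun s : R => (s - c) `^ (- p)) (c + e) (c + L) _ _ _).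
  - by rewrite lerD2l.
  - move=> t /andP[t1 _].
    have tc : 0 < t - c by rewrite subr_gt0 (lt_le_trans _ t1)// ltrDl.
    have h := is_derive_fun_scale (1 - p)^-1
      (@is_derive_fun_powR _ (fun s => s - c) t _ (1 - p) tc (dsc t)).
    apply: (is_derive_eq h).
    by rewrite subr0 mulr1 mulKf// addrAC subrr sub0r.
  - move=> t /andP[t1 _].
    have tc : 0 < t - c by rewrite subr_gt0 (lt_le_trans _ t1)// ltrDl.
    exact: is_derive_continuous (@is_derive_fun_powR _ (fun s => s - c) t _ (- p) tc (dsc t)).
rewrite lee_fin ![c + _]addrC !addrK ![_^-1 * _]mulrC; exact: powR_antideriv_le.
Qed.

Lemma integral_dist_powR_left (p c L e : R) : 0 < p < 1 -> 0 < e -> e <= L ->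
  (\int[leb]_(s in `[(c - L)%R, (c - e)%R]) (`|s - c| `^ (- p))%:E
    <= (L `^ (1 - p) / (1 - p))%:E)%E.
Proof.
move=> /andP[p0 p1] e0 eL.
have p10 : 1 - p != 0 by rewrite subr_eq0 gt_eqF.
have dsc (t : R) : is_derive t 1 (fun s : R => c - s) (0 - 1).
  exact: is_derive_fun_sub (is_derive_cst c _ _) (is_derive_id _ _).
have tcP t : c - L <= t <= c - e -> 0 < c - t.
  by move=> /andP[_ t1]; rewrite subr_gt0 (le_lt_trans t1)// gtrBl.
rewrite (eq_integral (fun s : mR => ((c - s) `^ (- p))%:E)); last first.
  move=> s; rewrite inE/= in_itv/= => /tcP h.
  by rewrite distrC gtr0_norm.
have -> : (\int[leb]_(s in `[(c - L)%R, (c - e)%R]) ((c - s) `^ (- p))%:E =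
    (- (1 - p)^-1 * (c - (c - e)) `^ (1 - p) - - (1 - p)^-1 * (c - (c - L)) `^ (1 - p))%:E)%E.
  refine (@integral_is_derive (fun s : R => - (1 - p)^-1 * (c - s) `^ (1 - p))
    (fun s : R => (c - s) `^ (- p)) (c - L) (c - e) _ _ _).
  - by rewrite lerD2l lerN2.
  - move=> t /tcP tc.
    have h := is_derive_fun_scale (- (1 - p)^-1)
      (@is_derive_fun_powR _ (fun s => c - s) t _ (1 - p) tc (dsc t)).
    apply: (is_derive_eq h).
    by rewrite sub0r mulrN1 mulrNN mulKf// addrAC subrr sub0r.
  - move=> t /tcP tc.
    exact: is_derive_continuous (@is_derive_fun_powR _ (fun s => c - s) t _ (- p) tc (dsc t)).
rewrite lee_fin !subKr !mulNr opprK addrC ![_^-1 * _]mulrC; exact: powR_antideriv_le.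
Qed.

(** The interval punctured at c is exhausted by the sets
1/(n+1) <= |s - c| <= L', on which the integrals computed above are uniformly
bounded; at s = c the integrand is 0 by convention. *)
Lemma integral_dist_powR_lty (p c L : R) : 0 < p < 1 ->
  (\int[leb]_s ((if `|s| <= L then `|s - c| `^ (- p) else 0)%R)%:E < +oo)%E.
Proof.
move=> hp; have /andP[p0 p1] := hp.
pose L' := `|L| + `|c| + 1.
have L'1 : 1 <= L' by rewrite lerDr addr_ge0.
pose A n : set mR := `[c + n.+1%:R^-1, (c + L')%R]%classic.
pose B n : set mR := `[c - L', (c - n.+1%:R^-1)%R]%classic.
pose F n := A n `|` B n.
pose C : \bar R := ((L' `^ (1 - p) / (1 - p))%:E + (L' `^ (1 - p) / (1 - p))%:E)%E.
have hF : (\int[leb]_(s in \bigcup_n F n) (`|s - c| `^ (- p))%:E <= C)%E.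
  apply: integral_exhaustion.
  - apply/nondecreasing_seqP => n; apply/subsetPset => s.
    have h : n.+2%:R^-1 <= n.+1%:R^-1 :> R by rewrite lef_pV2 ?posrE ?ltr0n// ler_nat.
    rewrite /F /A /B /= !in_itv/= => -[]/andP[h1 h2]; [left|right]; apply/andP; split => //.
      by rewrite (le_trans _ h1)// lerD2l.
    by rewrite (le_trans h2)// lerD2l lerN2.
  - by move=> n; apply: measurableU; exact: measurable_itv.
  - by move=> n; apply/measurable_EFinP; apply: measurable_funTS; exact: measurable_dist_powR.
  - by move=> n t _; rewrite lee_fin powR_ge0.
  - move=> n; have n0 : 0 < n.+1%:R^-1 :> R by rewrite invr_gt0 ltr0n.
    have nL : n.+1%:R^-1 <= L' by rewrite (le_trans _ L'1)// invf_le1 ?ltr0n// ler1n.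
    rewrite ge0_integral_setU//.
    + apply: leeD; first exact: integral_dist_powR_right.
      exact: integral_dist_powR_left.
    + exact: measurable_itv.
    + exact: measurable_itv.
    + by apply/measurable_EFinP; apply: measurable_funTS; exact: measurable_dist_powR.
    + apply: (introT disj_setPS) => s [].
      rewrite /A /B/= !in_itv/= => /andP[h1 _] /andP[_ h2].
      have := le_trans h1 h2; rewrite lerD2l.
      by rewrite leNgt (lt_trans _ n0)// oppr_lt0.
apply: (@le_lt_trans _ _ C); last by rewrite /C -EFinD ltry.
apply: le_trans hF.
have mU : measurable (\bigcup_n F n).
  by apply: bigcupT_measurable => n; apply: measurableU; exact: measurable_itv.
rewrite [leRHS]integral_mkcond; apply: ge0_le_integral => //.
- by move=> s _; rewrite lee_fin; case: ifP => // _; exact: powR_ge0.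
- apply/measurable_EFinP; apply: measurable_fun_ifT => //.
  + by apply: measurable_fun_ler => //; exact: normr_measurable.
  + exact: measurable_dist_powR.
- apply: (measurable_restrictT _ mU).1; apply: measurable_funTS.
  by apply/measurable_EFinP; exact: measurable_dist_powR.
move=> s _; rewrite patchE; have [hs|hs] := boolP (s \in \bigcup_n F n).
  by rewrite lee_fin; case: ifP => // _; rewrite powR_ge0.
rewrite lee_fin; case: ifPn => // sL.
have [->|sc] := eqVneq s c.
  by rewrite subrr normr0 powR0// oppr_eq0 gt_eqF.
exfalso; move/negP: hs; apply; rewrite inE.
have d0 : 0 < `|s - c| by rewrite normr_gt0 subr_eq0.
pose n := Num.truncn `|s - c|^-1.
have hn : n.+1%:R^-1 <= `|s - c|.
  rewrite -[leRHS]invrK lef_pV2 ?posrE ?invr_gt0 ?ltr0n//.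
  by apply/ltW; exact: truncnS_gt.
have hL : `|s - c| <= L'.
  rewrite (le_trans (ler_normB _ _))// /L' -addrA lerD//.
    by rewrite (le_trans sL)// ler_norm.
  by rewrite lerDl.
exists n => //; rewrite /F /A /B /= !in_itv/=.
have [h|h] := leP c s.
  left; move: hn hL; rewrite ger0_norm ?subr_ge0// lerBrDl lerBlDl => -> ->//.
right; move: hn hL; rewrite distrC gtr0_norm ?subr_gt0// lerBlDr lerBrDr => h1 h2.
by rewrite lerBlDr addrC h2/= lerBrDr addrC.
Qed.

End OneDim.

(** * Measurability of the kernels *)

Section Measurability.
Variable R : realType.
Local Notation mR := (measurableTypeR R).

Lemma measurable_gegenbauer_hom dd (T : measurableType dd) m lam (U V : T -> R) :
  measurable_fun setT U -> measurable_fun setT V ->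
  measurable_fun setT (fun t => gegenbauer_hom m lam (U t) (V t)).
Proof.
move=> mU mV.
suff: forall lam, measurable_fun setT (fun t => gegenbauer_hom m lam (U t) (V t)) /\
  measurable_fun setT (fun t => gegenbauer_hom m.+1 lam (U t) (V t)) by move=> /(_ lam)[].
elim: m => [|m IH] {}lam; split.
- exact: measurable_cst.
- under eq_fun do rewrite gegenbauer_homS.
  apply: measurable_funM => //.
  by apply: measurable_funB; apply: measurable_funM.
- exact: (IH lam).2.
under eq_fun do rewrite (gegenbauer_homS m.+1) shift1S.
apply: measurable_funM; first exact: measurable_cst.
apply: measurable_funB; apply: measurable_funM => //; first exact: (IH _).2.
exact: (IH _).1.
Qed.

Lemma measurable_scalar_kernel dd (T : measurableType dd) M lam (A U V : T -> R) :
  measurable_fun setT A -> measurable_fun setT U -> measurable_fun setT V ->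
  measurable_fun setT (fun t => scalar_kernel M lam (A t) (U t) (V t)).
Proof.
move=> mA mU mV; apply: measurable_funB.
  apply: (measurableT_comp (measurable_powR _)).
  apply: measurable_funD => //; apply: measurable_funB => //.
  by apply: measurable_funM.
apply: measurable_sum => m; apply: measurable_funM.
  by apply: (measurableT_comp (measurable_powR _)).
apply: measurable_gegenbauer_hom => //; exact: measurable_funM.
Qed.

Lemma measurable_coord_rV d i :
  measurable_fun setT (fun t : d.-tuple mR => rV_of_tuple t 0 i).
Proof.
rewrite (_ : (fun _ => _) = (@tnth _ mR ^~ i)); first exact: measurable_tnth.
by apply/funext => t; rewrite mxE.
Qed.

Lemma measurable_edot dd (T : measurableType dd) d (P Q : T -> 'rV[R]_d) :
  (forall i, measurable_fun setT (fun t => P t 0 i)) ->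
  (forall i, measurable_fun setT (fun t => Q t 0 i)) ->
  measurable_fun setT (fun t => edot (P t) (Q t)).
Proof. by move=> mP mQ; apply: measurable_sum => i; exact: measurable_funM. Qed.

Lemma measurable_edot_rV d (w : 'rV[R]_d) :
  measurable_fun setT (fun t : d.-tuple mR => edot w (rV_of_tuple t)).
Proof. by apply: measurable_edot => // i; exact: measurable_coord_rV. Qed.

Lemma measurable_enorm dd (T : measurableType dd) d (P : T -> 'rV[R]_d) :
  (forall i, measurable_fun setT (fun t => P t 0 i)) ->
  measurable_fun setT (fun t => enorm (P t)).
Proof.
move=> mP; rewrite (_ : (fun _ => _) = fun t => edot (P t) (P t) `^ (2^-1)).
  by apply: (measurableT_comp (measurable_powR _)); exact: measurable_edot.
by apply/funext => t; rewrite powR12_sqrt// edot_ge0.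
Qed.

End Measurability.

(** * Local integrability of the kernels *)

Section LocalIntegrability.
Variable R : realType.
Local Notation mR := (measurableTypeR R).
Variable d : nat.
Local Notation mu := (@lebesgue_tuple R d).
Local Notation rV := (@rV_of_tuple R d).

Lemma coord_le_enorm k (y : 'rV[R]_k) i : `|y 0 i| <= enorm y.
Proof.
have h := cauchy_schwarz y (basisv i).
by rewrite enorm_basis mulr1 edot_basis in h.
Qed.

Lemma measurable_kernel_near (c : 'rV[R]_d) (h lam rho : R) :
  measurable_fun setT (fun t => if enorm (rV t) <= rho then
    (enorm (rV t - c) ^+ 2 + h ^+ 2) `^ (- lam) else 0).
Proof.
apply: measurable_fun_ifT => //.
  apply: measurable_fun_ler => //; apply: measurable_enorm.
  exact: measurable_coord_rV.
apply: (measurableT_comp (measurable_powR _)); apply: measurable_funD => //.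
under eq_fun do rewrite sqr_enorm.
suff mc i : measurable_fun setT (fun t => (rV t - c) 0 i) by exact: measurable_edot.
rewrite (_ : (fun _ => _) = fun t => rV t 0 i - c 0 i); last first.
  by apply/funext => t; rewrite !mxE.
by apply: measurable_funB => //; exact: measurable_coord_rV.
Qed.

(** If q = |z|^2 + h^2, then q >= z_i^2 for each of the d coordinates z_i, so
q^(-lam) is at most the product of the |z_i|^(-2 lam / d), and each of these
exponents is larger than -1. This fails where some z_i vanishes, since
0^(-p) = 0 by convention, but only on a null set. *)
Lemma kernel_locally_integrable (c : 'rV[R]_d) (h lam rho : R) :
  0 < lam -> 2 * lam < d%:R ->
  (\int[mu]_t ((if enorm (rV t) <= rho then
     (enorm (rV t - c) ^+ 2 + h ^+ 2) `^ (- lam) else 0)%R)%:E < +oo)%E.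
Proof.
move=> lam0 lamd.
have d0 : 0 < d%:R :> R by rewrite (lt_trans _ lamd)// mulr_gt0.
pose p := 2 * lam / d%:R.
have hp : 0 < p < 1 by rewrite divr_gt0 ?mulr_gt0//= ltr_pdivrMr// mul1r.
pose phi (i : 'I_d) (s : mR) : R := if `|s| <= rho then `|s - c 0 i| `^ (- p) else 0.
have mphi i : measurable_fun setT (phi i).
  apply: measurable_fun_ifT => //; last exact: measurable_dist_powR.
  by apply: measurable_fun_ler => //; exact: normr_measurable.
have phi0 i s : 0 <= phi i s by rewrite /phi; case: ifP => // _; exact: powR_ge0.
apply: le_lt_trans (integral_tuple_prod mphi phi0 (fun i => integral_dist_powR_lty (c 0 i) rho hp)).
have mprod : measurable_fun setT (fun t : d.-tuple mR => \prod_(i < d) phi i (tnth t i)).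
  apply: measurable_prod => i _; apply: measurableT_comp => //.
  exact: measurable_tnth.
apply: ae_ge0_le_integral => //.
- by move=> t _; rewrite lee_fin; case: ifP => // _; exact: powR_ge0.
- by apply/measurable_EFinP; exact: measurable_kernel_near.
- by move=> t _; rewrite lee_fin prodr_ge0.
- exact/measurable_EFinP.
have [N [mN N0 hN]] := ae_coord_neq (fun i => c 0 i).
exists N; split => // t ht; apply: hN => hc; apply: ht => _ /=.
rewrite lee_fin; case: ifPn => [hrho|_]; last exact: prodr_ge0.
set q := _ + _.
have hq i : (tnth t i - c 0 i) ^+ 2 <= q.
  rewrite /q ler_wpDr ?sqr_ge0//.
  have := coord_le_enorm (rV t - c) i; rewrite !mxE => hi.
  by rewrite -(real_normK (num_real (_ - _))) lerXn2r ?nnegrE ?enorm_ge0.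
have hci i : 0 < (tnth t i - c 0 i) ^+ 2.
  by rewrite exprn_even_gt0//= subr_eq0 hc.
have -> : q `^ (- lam) = \prod_(i < d) q `^ (- (lam / d%:R)).
  rewrite prodr_const card_ord -powR_mulrn ?powR_ge0// -powRrM; congr (_ `^ _).
  by rewrite mulNr divfK// gt_eqF.
apply: ler_prod => i _; rewrite powR_ge0/= /phi.
have -> : `|tnth t i| <= rho.
  by rewrite (le_trans _ hrho)//; have := coord_le_enorm (rV t) i; rewrite mxE.
have -> : `|tnth t i - c 0 i| `^ (- p) = ((tnth t i - c 0 i) ^+ 2) `^ (- (lam / d%:R)).
  rewrite -(real_normK (num_real (_ - _))) -powR_mulrn// -powRrM; congr (_ `^ _).
  by rewrite /p mulrN mulrA.
rewrite !powRN lef_pV2 ?posrE ?powR_gt0//; last exact: lt_le_trans (hq i).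
rewrite ge0_ler_powR ?nnegrE ?sqr_ge0// ?divr_ge0 ?ltW//.
exact: lt_le_trans (hq i).
Qed.

End LocalIntegrability.

(** * Integrability on the space and on strips *)

Section SpatialKernel.
Variable R : realType.
Local Notation mR := (measurableTypeR R).
Variable d : nat.
Local Notation mu := (@lebesgue_tuple R d).
Local Notation rV := (@rV_of_tuple R d).
Local Notation leb := (@lebesgue_measure R).

(** K_M(lam, x, y') without angles, defined for y' = 0 as well. *)
Definition space_kernel M lam (x : 'rV[R]_d.+1) (y : 'rV[R]_d) : R :=
  scalar_kernel M lam (edot y y) (edot (bdry x) y) (edot x x).

Lemma space_kernel0E lam x y :
  space_kernel 0 lam x y = (enorm (y - bdry x) ^+ 2 + lastc x ^+ 2) `^ (- lam).
Proof. by rewrite /space_kernel scalar_kernel0 kernel_base. Qed.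

Lemma space_kernel0_ge0 lam x y : 0 <= space_kernel 0 lam x y.
Proof. by rewrite space_kernel0E powR_ge0. Qed.

Lemma edot_bdry_le x (y : 'rV[R]_d) : `|edot (bdry x) y| <= enorm x * enorm y.
Proof.
by rewrite (le_trans (cauchy_schwarz _ _))// ler_wpM2r ?enorm_ge0// enorm_bdry_le.
Qed.

Lemma measurable_space_kernel dd (T : measurableType dd) M lam
    (X : T -> 'rV[R]_d.+1) (Y : T -> 'rV[R]_d) :
  (forall j, measurable_fun setT (fun t => X t 0 j)) ->
  (forall j, measurable_fun setT (fun t => Y t 0 j)) ->
  measurable_fun setT (fun t => space_kernel M lam (X t) (Y t)).
Proof.
move=> mX mY; apply: measurable_scalar_kernel; apply: measurable_edot => // i.
rewrite (_ : (fun t => _) = fun t => X t 0 (lift ord_max i))//.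
by apply/funext => t; rewrite mxE.
Qed.

Lemma continuous_bounded_ball (f : 'rV[R]_d -> R) (L : R) : continuous f ->
  exists2 B : R, 0 <= B & forall y, enorm y <= L -> `|f y| <= B.
Proof.
move=> cf.
have cK : compact [set y : 'rV[R]_d | forall i, `[- L, L]%classic (y ord0 i)].
  by apply: (@rV_compact R d (fun=> `[- L, L]%classic)) => i; exact: segment_compact.
have /compact_bounded : compact (f @` [set y : 'rV[R]_d | forall i, `[- L, L]%classic (y ord0 i)]).
  by apply: continuous_compact => //; exact: continuous_subspaceT.
move=> [B0 [_ hB]]; exists (`|B0| + 1); first by rewrite addr_ge0.
move=> y yL; apply: (hB (`|B0| + 1)).
  by rewrite (le_lt_trans (ler_norm _))// ltrDl.
exists y => // i; rewrite /= in_itv/= -ler_norml (le_trans _ yL)//.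
exact: coord_le_enorm.
Qed.

Variables (f : 'rV[R]_d -> R) (delta : R) (N : nat).
Hypothesis cf : continuous f.
Hypothesis delta0 : 0 < delta.
Hypothesis fsupp : forall y, f y != 0 -> delta <= enorm y.

(** The integrand of the growth hypothesis on f. *)
Definition tail_weight (y : 'rV[R]_d) : R := `|f y| / (enorm y ^+ N + 1).

Hypothesis iW : mu.-integrable setT (fun t => (tail_weight (rV t))%:E).

Lemma tail_weight_ge0 y : 0 <= tail_weight y.
Proof. by rewrite divr_ge0// addr_ge0// exprn_ge0// enorm_ge0. Qed.

(** On the support of f, |y'| is bounded below by delta, so that large negative
powers of |y'| are dominated by smaller ones. *)
Lemma power_decay_le k p : (N + k <= p)%N -> exists2 C : R, 0 <= C & forall y,
  `|f y| * (enorm y ^+ k * enorm y `^ (- p%:R)) <= C * tail_weight y.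
Proof.
move=> Nkp; pose e := (p - k)%N.
have Ne : (N <= e)%N by rewrite leq_subRL ?(leq_trans _ Nkp) ?leq_addl// addnC.
exists ((delta ^+ (e - N))^-1 + (delta ^+ e)^-1).
  by rewrite addr_ge0// invr_ge0 exprn_ge0// ltW.
move=> y; rewrite /tail_weight; have [->|fy0] := eqVneq (f y) 0.
  by rewrite normr0 !mul0r mulr0.
have sd := fsupp fy0; set s := enorm y in sd *.
have s0 : 0 < s := lt_le_trans delta0 sd.
rewrite [leRHS]mulrCA ler_wpM2l// -/s.
have -> : s ^+ k * s `^ (- p%:R) = (s ^+ e)^-1.
  rewrite powRN powR_mulrn ?ltW// -(subnK (leq_trans (leq_addl N k) Nkp)) -/e.
  by rewrite exprD invfM mulrCA mulfV ?mulr1// expf_neq0// gt_eqF.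
have sN0 : 0 < s ^+ N + 1 by rewrite ltr_wpDl// exprn_ge0// ltW.
rewrite ler_pdivlMr// mulrDr mulr1 lerD//.
  rewrite -{1}(subnK Ne) exprD invfM mulfVK ?expf_neq0 ?gt_eqF//.
  by rewrite lef_pV2 ?posrE ?exprn_gt0// lerXn2r ?nnegrE ?(ltW delta0) ?(ltW s0).
by rewrite lef_pV2 ?posrE ?exprn_gt0// lerXn2r ?nnegrE ?(ltW delta0) ?(ltW s0).
Qed.

(** The common domination. The factor kappa is the derivative of the path, which
grows at most like |y'|^k with k = 0 or 1; it is kept inside the near part,
since for paths that reach the boundary it is what makes that part
integrable. *)
Lemma integrand_le M lam k p rho : 0 <= lam -> M%:R + 2 * lam = p%:R ->
  (N + k <= p)%N -> 0 <= rho -> exists2 C : R, 0 <= C &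
  forall x y kappa Ck, 0 <= Ck -> enorm x <= rho -> `|kappa| <= Ck * enorm y ^+ k ->
    `|kappa * f y * space_kernel M lam x y| <=
      (if enorm y <= 2 * rho then `|kappa * f y| * space_kernel 0 lam x y else 0) +
      Ck * C * tail_weight y.
Proof.
move=> lam0 Mp Nkp rho0.
have [C1 C10 h1] := scalar_kernel_bound M lam0 delta0 rho0.
have [C2 C20 h2] := power_decay_le Nkp.
exists (C1 * C2); first by rewrite mulr_ge0.
move=> x y kappa Ck Ck0 xrho hk.
have [->|fy0] := eqVneq (f y) 0.
  rewrite mulr0 mul0r normr0; apply: addr_ge0; first by case: ifP; rewrite ?mul0r.
  by apply: mulr_ge0; [rewrite !mulr_ge0|exact: tail_weight_ge0].
have sd := fsupp fy0.
have := h1 (enorm y) (enorm x) (edot (bdry x) y) sd _ (edot_bdry_le x y).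
rewrite enorm_ge0 xrho => /(_ isT); rewrite !sqr_enorm -/(space_kernel M lam x y).
rewrite -scalar_kernel0 -/(space_kernel 0 lam x y) => h.
rewrite normrM (le_trans (ler_wpM2l (normr_ge0 _) h))// mulrDr lerD//.
  by case: ifP => //; rewrite mulr0.
rewrite Mp mulrCA normrM.
have := h2 y => {}h2.
rewrite (_ : Ck * (C1 * C2) * _ = C1 * (Ck * (C2 * tail_weight y))); last by ring.
rewrite ler_wpM2l// -mulrA.
set e := enorm y `^ _ in h2 *.
have e0 : 0 <= e by exact: powR_ge0.
apply: (@le_trans _ _ ((Ck * enorm y ^+ k) * (`|f y| * e))).
  by rewrite ler_wpM2r// mulr_ge0.
rewrite (_ : _ * _ = Ck * (`|f y| * (enorm y ^+ k * e))); last by ring.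
by rewrite ler_wpM2l.
Qed.

(** Convergence of N_M[f](x), x being allowed to lie on the boundary. *)
Lemma integrable_spatial M lam p x : 0 < lam -> 2 * lam < d%:R ->
  M%:R + 2 * lam = p%:R -> (N <= p)%N ->
  mu.-integrable setT (fun t => (f (rV t) * space_kernel M lam x (rV t))%:E).
Proof.
move=> lam0 lamd Mp Np.
have Np0 : (N + 0 <= p)%N by rewrite addn0.
have [C C0 h] := integrand_le (ltW lam0) Mp Np0 (enorm_ge0 x).
have [B B0 hB] := continuous_bounded_ball (2 * enorm x) cf.
pose K t := if enorm (rV t) <= 2 * enorm x then
    (enorm (rV t - bdry x) ^+ 2 + lastc x ^+ 2) `^ (- lam) else 0.
have K0 t : 0 <= K t by rewrite /K; case: ifP => // _; exact: powR_ge0.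
have iK : mu.-integrable setT (fun t => (K t)%:E).
  apply/integrableP; split.
    by apply/measurable_EFinP; exact: measurable_kernel_near.
  under eq_integral do rewrite gee0_abs ?lee_fin//.
  exact: kernel_locally_integrable.
have iD : mu.-integrable setT (fun t => (B%:E * (K t)%:E + C%:E * (tail_weight (rV t))%:E)%E).
  by apply: integrableD => //; exact: integrableZl.
apply: le_integrable iD => //.
  apply/measurable_EFinP; apply: measurable_funM; first exact: measurable_continuous_rV.
  by apply: measurable_space_kernel => // j; exact: measurable_coord_rV.
move=> t _ /=; rewrite lee_fin.
rewrite [leRHS]ger0_norm; last by rewrite addr_ge0// mulr_ge0// tail_weight_ge0.
have := h x (rV t) 1 1 ler01 (lexx _); rewrite normr1 expr0 mulr1 => /(_ (lexx _)).
rewrite !mul1r => /le_trans; apply; rewrite lerD2r /K.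
case: ifP => [ht|_]; last by rewrite mulr0.
by rewrite -space_kernel0E ler_wpM2r ?space_kernel0_ge0// hB.
Qed.

Section Path.
Variables (X : R -> 'rV[R]_d.+1) (a b rho : R).
Hypothesis mX : forall j, measurable_fun setT (fun t : mR => X t 0 j).
Hypothesis rho0 : 0 <= rho.
Hypothesis Xrho : forall t, a <= t <= b -> enorm (X t) <= rho.

Lemma measurable_space_kernel_path M lam : measurable_fun setT (fun p : mR * d.-tuple mR =>
  space_kernel M lam (X p.1) (rV p.2)).
Proof.
apply: measurable_space_kernel => j.
  exact: (measurableT_comp (mX j) measurable_fst).
exact: (measurableT_comp (measurable_coord_rV j) measurable_snd).
Qed.

Lemma measurable_in_segment : measurable_fun setT (fun p : mR * d.-tuple mR => a <= p.1 <= b).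
Proof.
by apply: measurable_and; apply: measurable_fun_ler => //; exact: measurable_fst.
Qed.

(** Functions on [a, b] x R^d extended by 0, so that the Fubini theorems apply to
the full product. *)
Definition strip (h : R -> 'rV[R]_d -> R) (p : mR * d.-tuple mR) : R :=
  if a <= p.1 <= b then h p.1 (rV p.2) else 0.

Lemma measurable_strip (h : R -> 'rV[R]_d -> R) :
  measurable_fun setT (fun p : mR * d.-tuple mR => h p.1 (rV p.2)) ->
  measurable_fun setT (strip h).
Proof. by move=> mh; apply: measurable_fun_ifT => //; exact: measurable_in_segment. Qed.

Lemma integrable_strip_cst (g : 'rV[R]_d -> R) :
  mu.-integrable setT (fun t => (g (rV t))%:E) ->
  (leb \x mu)%E.-integrable setT (fun p => (strip (fun _ y => g y) p)%:E).
Proof.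
move=> ig.
have mg : measurable_fun setT (fun t => g (rV t)).
  by apply/measurable_EFinP; case/integrableP: ig.
have mS : measurable_fun setT (strip (fun _ y => g y)).
  by apply: measurable_strip; exact: (measurableT_comp mg measurable_snd).
apply/integrable12ltyP; first exact/measurable_EFinP.
case/integrableP: ig => _ ig.
pose I : \bar R := (\int[mu]_y `|(g (rV y))%:E|)%E.
have I0 : (0 <= I)%E by apply: integral_ge0.
apply: (@le_lt_trans _ _ (\int[leb]_(t in `[a, b]) (cst I t))%E).
  rewrite [leRHS]integral_mkcond.
  rewrite le_eqVlt; apply/orP; left; apply/eqP; apply: eq_integral => t _.
  rewrite patchE /strip/= -/I.
  have -> : (t \in `[a, b]%classic) = (a <= t <= b) by rewrite mem_setE in_itv.
  case: ifP => // _; rewrite integral0_eq// => y _ /=.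
  by rewrite normr0.
rewrite integral_cst; last exact: measurable_itv.
have mab : (lebesgue_measure `[a, b]%classic < +oo)%E.
  by rewrite lebesgue_measure_itv/= lte_fin; case: ifP => // _; rewrite -EFinB ltry.
by rewrite lte_mul_pinfty ?ge0_fin_numE.
Qed.

(** Reduces the integrability on the strip to that of the unmodified kernel near the
path. *)
Lemma integrable_strip_kernel M (lam : R) k p (kappa : R -> 'rV[R]_d -> R) (Ck : R) :
  0 <= lam -> M%:R + 2 * lam = p%:R -> (N + k <= p)%N -> 0 <= Ck ->
  measurable_fun setT (fun p : mR * d.-tuple mR => kappa p.1 (rV p.2)) ->
  (forall t y, a <= t <= b -> `|kappa t y| <= Ck * enorm y ^+ k) ->
  (leb \x mu)%E.-integrable setT (fun q => (strip (fun t y =>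
    if enorm y <= 2 * rho then `|kappa t y * f y| * space_kernel 0 lam (X t) y else 0) q)%:E) ->
  (leb \x mu)%E.-integrable setT (fun q => (strip (fun t y =>
    kappa t y * f y * space_kernel M lam (X t) y) q)%:E).
Proof.
move=> lam0 Mp Nkp Ck0 mk hk iE.
have [C C0 h] := integrand_le lam0 Mp Nkp rho0.
have iD := integrableD measurableT iE (integrableZl measurableT (Ck * C) (integrable_strip_cst iW)).
apply: le_integrable iD => //.
  apply/measurable_EFinP; apply: measurable_strip.
  apply: measurable_funM; last exact: measurable_space_kernel_path.
  apply: measurable_funM => //.
  exact: (measurableT_comp (measurable_continuous_rV cf) measurable_snd).
move=> [t y] _ /=; rewrite lee_fin /strip/=.
case: ifP => hab; last by rewrite mulr0 addr0.
rewrite (le_trans (h (X t) (rV y) (kappa t (rV y)) Ck _ _ _))// ?Xrho// ?hk//.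
exact: ler_norm.
Qed.

Lemma measurable_strip_near lam (kappa : R -> 'rV[R]_d -> R) :
  measurable_fun setT (fun p : mR * d.-tuple mR => kappa p.1 (rV p.2)) ->
  measurable_fun setT (strip (fun t y =>
    if enorm y <= 2 * rho then `|kappa t y| * space_kernel 0 lam (X t) y else 0)).
Proof.
move=> mk; apply: measurable_strip; apply: measurable_fun_ifT => //.
- apply: measurable_fun_ler => //; apply: measurable_enorm => i.
  exact: (measurableT_comp (measurable_coord_rV i) measurable_snd).
- apply: measurable_funM; last exact: measurable_space_kernel_path.
  by apply: measurableT_comp => //; exact: normr_measurable.
Qed.

(** First regime: the path stays at positive distance from the support of f. *)
Lemma integrable_near_separated (lam : R) k (kappa : R -> 'rV[R]_d -> R) (Ck c : R) : 0 < c ->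
  0 <= lam -> 0 <= Ck ->
  measurable_fun setT (fun p : mR * d.-tuple mR => kappa p.1 (rV p.2)) ->
  (forall t y, a <= t <= b -> `|kappa t y| <= Ck * enorm y ^+ k) ->
  (forall t y, a <= t <= b -> f y != 0 ->
    c <= enorm (y - bdry (X t)) ^+ 2 + lastc (X t) ^+ 2) ->
  (leb \x mu)%E.-integrable setT (fun q => (strip (fun t y =>
    if enorm y <= 2 * rho then `|kappa t y * f y| * space_kernel 0 lam (X t) y else 0) q)%:E).
Proof.
move=> c0 lam0 Ck0 mk hk hc.
pose C := Ck * (2 * rho) ^+ k * ((2 * rho) ^+ N + 1) * c `^ (- lam).
have r20 : 0 <= 2 * rho by rewrite mulr_ge0.
have C0 : 0 <= C by rewrite !mulr_ge0 ?addr_ge0 ?exprn_ge0 ?powR_ge0.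
have iD := integrableZl measurableT C (integrable_strip_cst iW).
apply: le_integrable iD => //.
  apply/measurable_EFinP; apply: (@measurable_strip_near lam (fun t y => kappa t y * f y)).
  apply: measurable_funM => //.
  exact: (measurableT_comp (measurable_continuous_rV cf) measurable_snd).
move=> [t y] _ /=; rewrite lee_fin /strip/=.
case: ifP => hab; last by rewrite mulr0.
rewrite [leRHS]ger0_norm; last by apply: mulr_ge0 => //; exact: tail_weight_ge0.
case: ifPn => hy; last by rewrite normr0 mulr_ge0// tail_weight_ge0.
have [->|fy0] := eqVneq (f (rV y)) 0.
  by rewrite mulr0 normr0 mul0r normr0 mulr_ge0// tail_weight_ge0.
rewrite ger0_norm; last by apply: mulr_ge0 => //; exact: space_kernel0_ge0.
have e0 := enorm_ge0 (rV y).
have h1 : space_kernel 0 lam (X t) (rV y) <= c `^ (- lam).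
  have hq := hc _ _ hab fy0; have q0 := lt_le_trans c0 hq.
  rewrite space_kernel0E !powRN lef_pV2 ?posrE ?powR_gt0//.
  by rewrite ge0_ler_powR ?nnegrE ?(ltW c0) ?(ltW q0).
have h2 : `|kappa t (rV y)| <= Ck * (2 * rho) ^+ k.
  by rewrite (le_trans (hk _ _ hab))// ler_wpM2l// lerXn2r ?nnegrE.
have h3 : `|f (rV y)| <= ((2 * rho) ^+ N + 1) * tail_weight (rV y).
  have eN : 0 < enorm (rV y) ^+ N + 1 by rewrite ltr_wpDl// exprn_ge0.
  rewrite /tail_weight mulrCA ler_peMr// ler_pdivlMr// mul1r lerD2r.
  by rewrite lerXn2r ?nnegrE.
rewrite normrM (_ : C * _ =
  Ck * (2 * rho) ^+ k * (((2 * rho) ^+ N + 1) * tail_weight (rV y)) * c `^ (- lam)); last first.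
  by rewrite /C; ring.
by rewrite !ler_pM ?mulr_ge0 ?space_kernel0_ge0 ?exprn_ge0.
Qed.

End Path.

End SpatialKernel.

(** * Exchange of integrals on a strip *)

Section FubiniStrip.
Variable R : realType.
Local Notation mR := (measurableTypeR R).
Variable d : nat.
Local Notation mu := (@lebesgue_tuple R d).
Local Notation rV := (@rV_of_tuple R d).
Local Notation leb := (@lebesgue_measure R).
Variables (a b : R).

Lemma integral_strip (h : R -> 'rV[R]_d -> R) (y : d.-tuple mR) :
  (\int[leb]_t (strip a b h (t, y))%:E = \int[leb]_(t in `[a, b]) (h t (rV y))%:E)%E.
Proof.
rewrite [RHS]integral_mkcond; apply: eq_integral => t _.
rewrite patchE /strip/=.
have -> : (t \in `[a, b]%classic) = (a <= t <= b) by rewrite mem_setE in_itv.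
by case: ifP.
Qed.

Lemma integrable_integral_strip (h : R -> 'rV[R]_d -> R) :
  (leb \x mu)%E.-integrable setT (fun p => (strip a b h p)%:E) ->
  mu.-integrable setT (fun y => (\int[leb]_(t in `[a, b]) (h t (rV y))%:E)%E).
Proof.
move=> ih.
under eq_fun do rewrite -integral_strip.
apply/integrableP; split; first exact: (measurable_fubini_G ih).
have mS : measurable_fun setT (fun p : mR * d.-tuple mR => `|(strip a b h p)%:E|%E).
  apply: measurableT_comp; first exact: abse_measurable.
  by case/integrableP: ih.
have S0 (p : mR * d.-tuple mR) : (0 <= `|(strip a b h p)%:E|)%E by [].
apply: (@le_lt_trans _ _ (\int[mu]_y \int[leb]_t `|(strip a b h (t, y))%:E|)%E).
  apply: ge0_le_integral => //.
  - apply: measurableT_comp; first exact: abse_measurable.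
    exact: (measurable_fubini_G ih).
  - exact: (measurable_fun_fubini_tonelli_G _ mS S0).
  - move=> y _; apply: le_abse_integral => //.
    apply/measurable_EFinP; case/integrableP: ih => /measurable_EFinP mh _.
    exact: (measurableT_comp mh (measurable_pair2 y)).
rewrite -(fubini_tonelli2 _ mS S0).
by case/integrableP: ih.
Qed.

(** The positive and negative parts depend measurably on the parameter by Tonelli,
and so does their difference, also where it is infinite. *)
Lemma measurable_Rintegral_param (k : R -> 'rV[R]_d -> R) :
  measurable_fun setT (fun p : mR * d.-tuple mR => k p.1 (rV p.2)) ->
  measurable_fun setT (fun t : mR => \int[mu]_y k t (rV y)).
Proof.
move=> mk.
have mkE : measurable_fun setT (fun p : mR * d.-tuple mR => (k p.1 (rV p.2))%:E).
  exact/measurable_EFinP.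
pose kE (p : mR * d.-tuple mR) : \bar R := (k p.1 (rV p.2))%:E.
have mp : measurable_fun setT (kE^\+)%E by exact: measurable_funepos.
have mn : measurable_fun setT (kE^\-)%E by exact: measurable_funeneg.
have h1 := measurable_fun_fubini_tonelli_F (m2 := mu) _ mp (funepos_ge0 kE).
have h2 := measurable_fun_fubini_tonelli_F (m2 := mu) _ mn (funeneg_ge0 kE).
have hI : measurable_fun setT (fun t : mR => \int[mu]_y (k t (rV y))%:E)%E.
  rewrite (_ : (fun t => _) = (fun t => fubini_F mu kE^\+ t - fubini_F mu kE^\- t)%E).
    exact: (emeasurable_funB h1 h2).
  apply/funext => t; rewrite integralE; congr (_ - _)%E.
    by apply: eq_integral => y _; rewrite !funeposE.
  by apply: eq_integral => y _; rewrite !funenegE.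
exact: (measurableT_comp (fine_measurable measurableT) hI).
Qed.

(** The inner integral may diverge for exceptional t, for instance where the path
meets the boundary; by Fubini such t form a null set. The factor beta is kept
outside the inner integral, which is then an operator D up to a factor. *)
Lemma fubini_strip (beta : R -> R) (k : R -> 'rV[R]_d -> R) :
  measurable_fun setT (beta : mR -> R) ->
  measurable_fun setT (fun p : mR * d.-tuple mR => k p.1 (rV p.2)) ->
  (leb \x mu)%E.-integrable setT
    (fun p => (strip a b (fun t y => beta t * k t y) p)%:E) ->
  (\int[leb]_(t in `[a, b]) (beta t * \int[mu]_y k t (rV y))%:E =
   \int[mu]_y \int[leb]_(t in `[a, b]) (beta t * k t (rV y))%:E)%E.
Proof.
move=> mb mk ih.
under [RHS]eq_integral do rewrite -(integral_strip (fun t y => beta t * k t y)).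
rewrite -(Fubini ih) [LHS]integral_mkcond.
apply: ae_eq_integral => //.
- apply: (measurable_restrictT _ (measurable_itv _)).1.
  apply: measurable_funTS; apply/measurable_EFinP; apply: measurable_funM => //.
  exact: measurable_Rintegral_param.
- exact: (measurable_fubini_F ih).
have := ae_integrable1 ih; apply: filterS => t it _.
rewrite patchE.
have -> : (t \in `[a, b]%classic) = (a <= t <= b) by rewrite mem_setE in_itv.
rewrite /strip/= in it *; case: ifP it => [_ it|_ _]; last by rewrite integral0.
have [->|bt] := eqVneq (beta t) 0.
  by rewrite mul0r integral0_eq// => y _; rewrite mul0r.
have ik : mu.-integrable setT (fun y => (k t (rV y))%:E).
  have := integrableZl measurableT (beta t)^-1 it.
  by under eq_fun do rewrite -EFinM mulKf//.
under [RHS]eq_integral do rewrite EFinM.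
rewrite integralZl// EFinM fineK//.
exact: integrable_fin_num.
Qed.

End FubiniStrip.

(** * Integrability along paths that reach the boundary *)

Section GradientFormula.
Variable R : realType.
Local Notation mR := (measurableTypeR R).
Variable d : nat.
Local Notation mu := (@lebesgue_tuple R d).
Local Notation rV := (@rV_of_tuple R d).
Local Notation leb := (@lebesgue_measure R).
Implicit Types (lam : R) (x : 'rV[R]_d.+1) (y : 'rV[R]_d).

Lemma is_derive_space_kernel M lam (X : R -> 'rV[R]_d.+1) y t du dv :
  y != 0 ->
  0 < enorm (y - bdry (X t)) ^+ 2 + lastc (X t) ^+ 2 ->
  is_derive t 1 (fun t => edot (bdry (X t)) y) du ->
  is_derive t 1 (fun t => edot (X t) (X t)) dv ->
  is_derive t 1 (fun t => space_kernel M lam (X t) y)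
   (2 * lam * du * space_kernel M.-1 (lam + 1) (X t) y
    - lam * dv * space_kernel M.-2 (lam + 1) (X t) y).
Proof.
rewrite kernel_base => y0 q0 hu hv; apply: (is_derive_scalar_kernel M lam _ q0 hu hv).
by rewrite lt_def edot_eq0 y0 edot_ge0.
Qed.

Variables (f : 'rV[R]_d -> R).
Hypothesis cf : continuous f.

Variables (X : R -> 'rV[R]_d.+1) (a b rho : R).
Hypothesis ab : a <= b.
Hypothesis mX : forall j, measurable_fun setT (fun t : mR => X t 0 j).

(** Second regime. As q = |y'-y|^2 + x_n^2 has derivative sigma kappa, the function
kappa q^(-lam-1) is a constant multiple of the derivative of q^(-lam). When
kappa has a constant sign in t, the integral in t of its absolute value is at
most a multiple of the sum of q^(-lam) at both end points, which is locally
integrable in y' since 2 lam < d; Tonelli concludes. The end points themselves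
may lie on the boundary. *)
Lemma integrable_near_monotone lam (kappa : R -> 'rV[R]_d -> R) (sigma : R) :
  0 < lam -> 2 * lam < d%:R -> sigma != 0 ->
  measurable_fun setT (fun p : mR * d.-tuple mR => kappa p.1 (rV p.2)) ->
  (forall (t : R) y, is_derive t 1 (fun t => edot y y - 2 * edot (bdry (X t)) y +
      edot (X t) (X t)) (sigma * kappa t y)) ->
  (forall (t : R) y, {for t, continuous (kappa^~ y)}) ->
  (forall y, (forall t, a <= t <= b -> 0 <= kappa t y) \/
             (forall t, a <= t <= b -> kappa t y <= 0)) ->
  {ae mu, forall s, forall t, a <= t <= b ->
     0 < enorm (rV s - bdry (X t)) ^+ 2 + lastc (X t) ^+ 2} ->
  (leb \x mu)%E.-integrable setT (fun q => (strip a b (fun t y =>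
    if enorm y <= 2 * rho then `|kappa t y * f y| * space_kernel 0 (lam + 1) (X t) y else 0) q)%:E).
Proof.
move=> lam0 lamd sigma0 mk hdq hcont hsign hq.
have [B B0 hB] := continuous_bounded_ball (2 * rho) cf.
pose e0 t y := if enorm y <= 2 * rho then `|kappa t y| * space_kernel 0 (lam + 1) (X t) y else 0.
have e0_ge0 t y : 0 <= e0 t y.
  by rewrite /e0; case: ifP => // _; rewrite mulr_ge0// space_kernel0_ge0.
have mE0 : measurable_fun setT (strip a b e0) by exact: measurable_strip_near.
have S0 (p : mR * d.-tuple mR) : 0 <= strip a b e0 p.
  by rewrite /strip; case: ifP.
suff iE0 : (leb \x mu)%E.-integrable setT (fun q => (strip a b e0 q)%:E).
  have iD := integrableZl measurableT B iE0.
  apply: le_integrable iD => //.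
    apply/measurable_EFinP.
    apply: (@measurable_strip_near _ _ X a b rho mX (lam + 1)
      (fun t y => kappa t y * f y)).
    apply: measurable_funM => //.
    exact: (measurableT_comp (measurable_continuous_rV cf) measurable_snd).
  move=> [t y] _ /=; rewrite lee_fin /strip/= /e0.
  case: ifP => hab; last by rewrite mulr0.
  case: ifPn => hy; last by rewrite mulr0.
  rewrite !normrM !normr_id (ger0_norm B0) (ger0_norm (space_kernel0_ge0 _ _ _)).
  rewrite [`|kappa _ _| * `|f _|]mulrC -mulrA ler_wpM2r ?hB//.
  by rewrite mulr_ge0// space_kernel0_ge0.
have mE0E : measurable_fun setT (fun q => (strip a b e0 q)%:E) by exact/measurable_EFinP.
apply/integrable12ltyP => //.
under eq_integral => t _ do under eq_integral => y _ do rewrite gee0_abs ?lee_fin//.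
rewrite (@fubini_tonelli _ _ _ _ _ leb mu _ mE0E); last by move=> p; rewrite lee_fin.
pose c := `|(- lam * sigma)^-1|.
pose K x (s : d.-tuple mR) := if enorm (rV s) <= 2 * rho then
    (enorm (rV s - bdry x) ^+ 2 + lastc x ^+ 2) `^ (- lam) else 0.
have K0 x s : 0 <= K x s by rewrite /K; case: ifP => // _; exact: powR_ge0.
have mK x : measurable_fun setT (K x) by exact: measurable_kernel_near.
apply: (@le_lt_trans _ _ (\int[mu]_s (c%:E * ((K (X a) s)%:E + (K (X b) s)%:E)))%E); last first.
  rewrite ge0_integralZl//; last 3 first.
  - by apply: emeasurable_funD; exact/measurable_EFinP.
  - by move=> s _; rewrite adde_ge0// lee_fin.
  - by rewrite lee_fin /c.
  rewrite ge0_integralD//; last 4 first.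
  - by move=> s _; rewrite lee_fin.
  - exact/measurable_EFinP.
  - by move=> s _; rewrite lee_fin.
  - exact/measurable_EFinP.
  rewrite lte_mul_pinfty// ?lee_fin /c// lte_add_pinfty//; exact: kernel_locally_integrable.
apply: ae_ge0_le_integral => //.
- by move=> s _; apply: integral_ge0 => t _; rewrite lee_fin.
- exact: (measurable_fun_fubini_tonelli_G _ mE0E (fun p => S0 p)).
- by move=> s _; rewrite mule_ge0 ?lee_fin ?normr_ge0// addr_ge0.
- by apply: emeasurable_funM => //; apply: emeasurable_funD; exact/measurable_EFinP.
apply: filterS hq => s hqs _.
rewrite integral_strip /e0 /K.
case: ifPn => hs; last by rewrite integral0 adde0 mule0.
set y := rV s in hqs hs *.
have [eps he] : exists2 eps : R, `|eps| = 1 &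
    forall t, a <= t <= b -> `|kappa t y| = eps * kappa t y.
  have [h|h] := hsign y.
    by exists 1; rewrite ?normr1// => t ht; rewrite mul1r ger0_norm// h.
  by exists (-1); rewrite ?normrN1// => t ht; rewrite mulN1r ler0_norm// h.
move=> hk.
have cn0 : - lam * sigma != 0 by rewrite mulf_neq0// oppr_eq0 gt_eqF.
have dF (t : R) : a <= t <= b -> is_derive t 1
    (fun t => eps * (- lam * sigma)^-1 * space_kernel 0 lam (X t) y)
    (eps * kappa t y * space_kernel 0 (lam + 1) (X t) y).
  move=> ht; have q0 := hqs t ht; rewrite kernel_base in q0.
  have h := is_derive_fun_scale (eps * (- lam * sigma)^-1)
    (@is_derive_fun_powR _ (fun t => edot y y - 2 * edot (bdry (X t)) y +
      edot (X t) (X t)) t _ (- lam) q0 (hdq t y)).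
  under eq_fun do rewrite /space_kernel scalar_kernel0.
  apply: (is_derive_eq h); rewrite /space_kernel scalar_kernel0 -opprD.
  rewrite [LHS](_ : _ = eps * ((- lam * sigma)^-1 * (- lam * sigma)) *
    (kappa t y * (edot y y - 2 * edot (bdry (X t)) y + edot (X t) (X t)) `^ (- (lam + 1)))); last by ring.
  by rewrite mulVf// mulr1 mulrA.
have cont (t : R) : a <= t <= b ->
    {for t, continuous (fun t => eps * kappa t y * space_kernel 0 (lam + 1) (X t) y)}.
  move=> ht; apply: cvgM; first by apply: cvgM; [exact: cvg_cst|exact: hcont].
  have q0 := hqs t ht; rewrite kernel_base in q0.
  under eq_fun do rewrite /space_kernel scalar_kernel0.
  rewrite /space_kernel scalar_kernel0.
  exact: is_derive_continuous (@is_derive_fun_powR _ (fun t => edot y y - 2 * edot (bdry (X t)) y +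
      edot (X t) (X t)) t _ (- (lam + 1)) q0 (hdq t y)).
rewrite (@eq_integral _ mR _ _ _
  (fun t => (eps * kappa t y * space_kernel 0 (lam + 1) (X t) y)%:E)); last first.
  by move=> t; rewrite inE/= in_itv/= => ht; rewrite hk.
have -> := integral_is_derive ab dF cont.
rewrite -!space_kernel0E -EFinD -EFinM lee_fin -mulrBr (le_trans (ler_norm _))//.
rewrite !normrM he mul1r -/c. rewrite ler_wpM2l ?/c ?normr_ge0// (le_trans (ler_normB _ _))//.
by rewrite !ger0_norm ?space_kernel0_ge0// addrC.
Qed.

End GradientFormula.

(** * The fundamental theorem of calculus along a path *)

Section LineIntegral.
Variable R : realType.
Local Notation mR := (measurableTypeR R).
Variable d : nat.
Local Notation mu := (@lebesgue_tuple R d).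
Local Notation rV := (@rV_of_tuple R d).
Local Notation leb := (@lebesgue_measure R).
Implicit Types (lam : R) (x : 'rV[R]_d.+1) (y : 'rV[R]_d).

Lemma continuous_integrable_itv (g : R -> R) (a b : R) :
  (forall t, a <= t <= b -> {for t, continuous g}) ->
  leb.-integrable `[a, b]%classic (fun t => (g t)%:E).
Proof.
move=> cg; apply: (@continuous_compact_integrable R g); first exact: segment_compact.
by apply: continuous_in_subspaceT => t; rewrite inE/= in_itv/=; exact: cg.
Qed.

Variables (f : 'rV[R]_d -> R) (delta : R) (N : nat).
Hypothesis cf : continuous f.
Hypothesis delta0 : 0 < delta.
Hypothesis fsupp : forall y, f y != 0 -> delta <= enorm y.
Hypothesis iW : mu.-integrable setT (fun t => (tail_weight f N (rV t))%:E).

(** For almost every y' the fundamental theorem applies to the kernel along the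
path; integrating in y' and exchanging the integrals in each of the two terms
separately gives the result. *)
Lemma line_integral (X : R -> 'rV[R]_d.+1) (a b : R) M lam p (w : 'rV[R]_d) (beta gamma : R -> R) :
  a <= b ->
  (forall j, measurable_fun setT (fun t : mR => X t 0 j)) ->
  0 < lam -> 2 * lam < d%:R -> M%:R + 2 * lam = p%:R -> (N <= p)%N ->
  (forall t : R, {for t, continuous beta}) ->
  (forall t : R, {for t, continuous gamma}) ->
  (forall (t : R) y, is_derive t 1 (fun t => edot (bdry (X t)) y) (beta t * edot w y)) ->
  (forall t : R, is_derive t 1 (fun t => edot (X t) (X t)) (2 * gamma t)) ->
  {ae mu, forall s, f (rV s) != 0 -> forall t, a <= t <= b ->
     0 < enorm (rV s - bdry (X t)) ^+ 2 + lastc (X t) ^+ 2} ->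
  (leb \x mu)%E.-integrable setT (fun q => (strip a b (fun t y =>
    beta t * (edot w y * f y * space_kernel M.-1 (lam + 1) (X t) y)) q)%:E) ->
  (leb \x mu)%E.-integrable setT (fun q => (strip a b (fun t y =>
    gamma t * (f y * space_kernel M.-2 (lam + 1) (X t) y)) q)%:E) ->
  integral_Rd (fun y => f y * space_kernel M lam (X b) y) -
  integral_Rd (fun y => f y * space_kernel M lam (X a) y) =
  2 * lam *
  (\int[leb]_(t in `[a, b]) (beta t *
     integral_Rd (fun y => edot w y * f y * space_kernel M.-1 (lam + 1) (X t) y)) -
   \int[leb]_(t in `[a, b]) (gamma t *
     integral_Rd (fun y => f y * space_kernel M.-2 (lam + 1) (X t) y))).
Proof.
move=> ab mX lam0 lamd Mp Np cb cg hu hv hq H1 H2.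
pose k1 t y := edot w y * f y * space_kernel M.-1 (lam + 1) (X t) y.
pose k2 t y := f y * space_kernel M.-2 (lam + 1) (X t) y.
pose K1 s := (\int[leb]_(t in `[a, b]) (beta t * k1 t (rV s))%:E)%E.
pose K2 s := (\int[leb]_(t in `[a, b]) (gamma t * k2 t (rV s))%:E)%E.
have mf2 : measurable_fun setT (fun q : mR * d.-tuple mR => f (rV q.2)).
  exact: (measurableT_comp (measurable_continuous_rV cf) measurable_snd).
have mk2 : measurable_fun setT (fun q : mR * d.-tuple mR => k2 q.1 (rV q.2)).
  by apply: measurable_funM => //; exact: measurable_space_kernel_path.
have mk1 : measurable_fun setT (fun q : mR * d.-tuple mR => k1 q.1 (rV q.2)).
  apply: measurable_funM; last exact: measurable_space_kernel_path.
  apply: measurable_funM => //.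
  exact: (measurableT_comp (measurable_edot_rV w) measurable_snd).
have mcont (g : R -> R) : (forall t, {for t, continuous g}) -> measurable_fun setT (g : mR -> R).
  by move=> cg'; apply: continuous_measurable_fun => t; exact: cg'.
have iK1 : mu.-integrable setT K1 := integrable_integral_strip H1.
have iK2 : mu.-integrable setT K2 := integrable_integral_strip H2.
have E1 := fubini_strip (mcont _ cb) mk1 H1.
have E2 := fubini_strip (mcont _ cg) mk2 H2.
have iG x := integrable_spatial cf delta0 fsupp iW x lam0 lamd Mp Np.
have -> : \int[leb]_(t in `[a, b]) (beta t * integral_Rd (k1 t)) = fine (\int[mu]_s K1 s)%E.
  exact: congr1 E1.
have -> : \int[leb]_(t in `[a, b]) (gamma t * integral_Rd (k2 t)) = fine (\int[mu]_s K2 s)%E.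
  exact: congr1 E2.
rewrite /integral_Rd -RintegralB//; try exact: iG.
rewrite /Rintegral.
have -> : (\int[mu]_y (f (rV y) * space_kernel M lam (X b) (rV y) -
     f (rV y) * space_kernel M lam (X a) (rV y))%:E =
   \int[mu]_y ((2 * lam)%:E * (K1 y - K2 y)))%E.
  apply: ae_eq_integral => //.
  - apply/measurable_EFinP; apply: measurable_funB; apply/measurable_EFinP;
      by case/integrableP: (iG (X b)); case/integrableP: (iG (X a)).
  - by case/integrableP: (integrableZl measurableT (2 * lam) (integrableB measurableT iK1 iK2)).
  apply: filterS hq => s hqs _.
  have [f0|f0] := eqVneq (f (rV s)) 0.
    rewrite f0 !mul0r subrr /K1 /K2 /k1 /k2 f0.
    rewrite !integral0_eq ?sube0 ?mule0// => t _; by rewrite !(mulr0, mul0r).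
  set y := rV s in hqs f0 *.
  have y0 : y != 0.
    by rewrite -enorm_gt0 (lt_le_trans delta0)// fsupp.
  have hx M' l t : a <= t <= b -> {for t, continuous (fun t => space_kernel M' l (X t) y)}.
    move=> ht.
    exact: is_derive_continuous (is_derive_space_kernel M' l y0 (hqs f0 t ht) (hu t y) (hv t)).
  have c1 t : a <= t <= b -> {for t, continuous (fun t => beta t * k1 t y)}.
    move=> ht; apply: cvgM; first exact: cb.
    by apply: cvgM; [exact: cvg_cst|exact: hx].
  have c2 t : a <= t <= b -> {for t, continuous (fun t => gamma t * k2 t y)}.
    move=> ht; apply: cvgM; first exact: cg.
    by apply: cvgM; [exact: cvg_cst|exact: hx].
  have i1 := continuous_integrable_itv c1.
  have i2 := continuous_integrable_itv c2.
  have mab : measurable (`[a, b]%classic : set mR) by exact: measurable_itv.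
  rewrite /K1 /K2 -(integralB mab i1 i2) -(integralZl mab (integrableB mab i1 i2)).
  have E : (\int[leb]_(t in `[a, b]) (2 * lam * (beta t * k1 t y - gamma t * k2 t y))%:E =
      (f y * space_kernel M lam (X b) y - f y * space_kernel M lam (X a) y)%:E)%E.
    refine (@integral_is_derive _ (fun t => f y * space_kernel M lam (X t) y)
      (fun t => 2 * lam * (beta t * k1 t y - gamma t * k2 t y)) a b ab _ _) => t ht.
      apply: (is_derive_eq (is_derive_fun_scale (f y)
        (is_derive_space_kernel M lam y0 (hqs f0 t ht) (hu t y) (hv t)))).
      by rewrite /k1 /k2; ring.
    apply: cvgM; first exact: cvg_cst.
    by apply: cvgB; [exact: c1|exact: c2].
  by rewrite -E; apply: eq_integral => t _; rewrite -EFinB -EFinM.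
rewrite integralZl//; last exact: integrableB.
rewrite integralB//.
rewrite -[in LHS](fineK (integrable_fin_num measurableT iK1)).
rewrite -[in LHS](fineK (integrable_fin_num measurableT iK2)).
by rewrite -EFinB -EFinM.
Qed.

End LineIntegral.

(** * Oriented integrals *)

Section OrientedIntegral.
Variable R : realType.
Local Notation mR := (measurableTypeR R).
Local Notation leb := (@lebesgue_measure R).

(** If g is measurable but not integrable, both sides are 0: one of the integrals of
the positive and negative parts is infinite, hence so is their difference, and
an infinite integral counts as 0. *)
Lemma RintegralZ_measurable dd (T : measurableType dd) (nu : {measure set T -> \bar R})
    (D : set T) (g : T -> R) (r : R) : measurable D -> measurable_fun D g ->
  \int[nu]_(t in D) (r * g t) = r * \int[nu]_(t in D) g t.
Proof.
move=> mD mg; have [->|r0] := eqVneq r 0.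
  by rewrite mul0r (@eq_Rintegral _ _ _ _ _ (cst 0)) ?Rintegral_cst ?mul0r// => t _; rewrite mul0r.
have mgE : measurable_fun D (EFin \o g) by exact/measurable_EFinP.
have mrgE : measurable_fun D (fun t => (r * g t)%:E).
  by apply/measurable_EFinP; exact: measurable_funM.
have [h|h] := boolP (\int[nu]_(t in D) (g t)%:E \is a fin_num)%E.
  apply: RintegralZl => //; apply/integrableP; split => //.
  by rewrite integral_fin_num_abs.
have h' : ~~ (\int[nu]_(t in D) (r * g t)%:E \is a fin_num)%E.
  apply: contra h => h.
  have ir : nu.-integrable D (fun t => (r * g t)%:E).
    by apply/integrableP; split => //; rewrite integral_fin_num_abs//; apply: measurable_funM.
  have := integrableZl mD r^-1 ir.
  under eq_fun do rewrite -EFinM mulKf//.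
  exact: integrable_fin_num.
rewrite /Rintegral.
move: h h'; rewrite !fin_numE !negb_and !negbK.
by move=> /orP[]/eqP-> /orP[]/eqP->; rewrite /= mulr0.
Qed.

Implicit Types (a b r : R).

Lemma oriented_integralZ a b r (g : R -> R) : measurable_fun setT (g : mR -> R) ->
  oriented_integral a b (fun t => r * g t) = r * oriented_integral a b g.
Proof.
move=> mg.
have mg' (D : set mR) : measurable_fun D (g : mR -> R) by exact: measurable_funTS.
rewrite /oriented_integral; case: ifP => _; rewrite RintegralZ_measurable//;
  try exact: measurable_itv.
by rewrite mulrN.
Qed.

Lemma eq_oriented_integral a b (g h : R -> R) :
  (forall t, Num.min a b <= t <= Num.max a b -> g t = h t) ->
  oriented_integral a b g = oriented_integral a b h.
Proof.
move=> gh; rewrite /oriented_integral; have [ab|ba] := leP a b.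
  by apply: eq_Rintegral => t; rewrite inE/= in_itv/= => ht; apply: gh; rewrite min_l// max_r.
congr (- _).
by apply: eq_Rintegral => t; rewrite inE/= in_itv/= => ht; apply: gh; rewrite min_r ?max_l// ltW.
Qed.

(** Needed for the quotient by t in the dilation formula, which at t = 0 is 0 by
convention. *)
Lemma ae_eq_oriented_integral a b c (g h : R -> R) :
  measurable_fun setT (g : mR -> R) -> measurable_fun setT (h : mR -> R) ->
  (forall t, t != c -> g t = h t) ->
  oriented_integral a b g = oriented_integral a b h.
Proof.
move=> mg mh gh.
suff key (D : set mR) : measurable D -> \int[leb]_(t in D) g t = \int[leb]_(t in D) h t.
  by rewrite /oriented_integral !key//; exact: measurable_itv.
move=> mD; rewrite /Rintegral; congr fine; apply: ae_eq_integral => //.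
- by apply: measurable_funTS; exact/measurable_EFinP.
- by apply: measurable_funTS; exact/measurable_EFinP.
exists [set c]; split => //; first exact: lebesgue_measure_set1.
move=> t /= ht; apply/eqP; apply: contraT => tc; exfalso; apply: ht => _.
by rewrite gh.
Qed.

Lemma oriented_integral0 a b : oriented_integral a b (fun=> 0) = 0.
Proof.
rewrite /oriented_integral /Rintegral !integral0 /=.
by case: ifP; rewrite ?oppr0.
Qed.

Lemma continuous_bounded_segment (g : R -> R) a b : (forall t : R, {for t, continuous g}) ->
  exists2 C : R, 0 <= C & forall t, a <= t <= b -> `|g t| <= C.
Proof.
move=> cg.
have : compact (g @` `[a, b]%classic).
  apply: continuous_compact; last exact: segment_compact.
  by apply: continuous_subspaceT => t; exact: cg.
move=> /compact_bounded[B0 [_ hB]]; exists (`|B0| + 1); first by rewrite addr_ge0.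
move=> t ht; apply: (hB (`|B0| + 1)).
  by rewrite (le_lt_trans (ler_norm _))// ltrDl.
by exists t => //=; rewrite in_itv.
Qed.

End OrientedIntegral.

(** * The operators N and D in terms of the kernels *)

Section PotentialsAlongPaths.
Variable R : realType.
Local Notation mR := (measurableTypeR R).
Variable d : nat.
Local Notation mu := (@lebesgue_tuple R d).
Local Notation rV := (@rV_of_tuple R d).
Local Notation leb := (@lebesgue_measure R).
Implicit Types (lam : R) (x : 'rV[R]_d.+1) (y : 'rV[R]_d).

Local Notation lamN := ((d.+1%:R - 2) / 2 : R).
Local Notation lamD := (d.+1%:R / 2 : R).

Lemma mul_kerKM (g : 'rV[R]_d -> R) M lam x : (forall y, g y != 0 -> y != 0) ->
  (fun y => g y * kerKM M lam x y) = (fun y => g y * space_kernel M lam x y).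
Proof.
move=> g0; apply/funext => y; have [->|/g0 y0] := eqVneq (g y) 0.
  by rewrite !mul0r.
by rewrite kerKM_space_kernel.
Qed.

Lemma opNME M (g : 'rV[R]_d -> R) x : (forall y, g y != 0 -> y != 0) ->
  opNM M g x = alpha R d.+1 / (d.+1%:R - 2) * integral_Rd (fun y => g y * space_kernel M lamN x y).
Proof. by move=> g0; rewrite /opNM mul_kerKM. Qed.

(** Both branches of [opDz] agree with truncated subtraction of indices. *)
Lemma opDzE M k (g : 'rV[R]_d -> R) x : (forall y, g y != 0 -> y != 0) ->
  opDz (M%:Z - k%:Z) g x =
  alpha R d.+1 * lastc x * integral_Rd (fun y => g y * space_kernel (M - k) lamD x y).
Proof.
move=> g0; rewrite /opDz subr_le0 lez_nat; case: leqP => Mk.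
  rewrite (eqP Mk) /opD; congr (_ * integral_Rd _); apply/funext => y.
  by rewrite space_kernel0E.
rewrite /opDM subzn ?(ltnW Mk)// absz_nat.
by rewrite mul_kerKM.
Qed.

Lemma measurable_opDz M k (g : 'rV[R]_d -> R) (X : R -> 'rV[R]_d.+1) :
  (forall y, g y != 0 -> y != 0) -> measurable_fun setT (fun t => g (rV t)) ->
  (forall j, measurable_fun setT (fun t : mR => X t 0 j)) ->
  measurable_fun setT (fun t : mR => opDz (M%:Z - k%:Z) g (X t)).
Proof.
move=> g0 mg mX.
rewrite (_ : (fun _ => _) = fun t => alpha R d.+1 * lastc (X t) *
   integral_Rd (fun y => g y * space_kernel (M - k) lamD (X t) y)); last first.
  by apply/funext => t; exact: opDzE.
apply: measurable_funM.
  by apply: measurable_funM => //; exact: (mX ord_max).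
apply: (@measurable_Rintegral_param _ _ (fun t y => g y * space_kernel (M - k) lamD (X t) y)).
apply: measurable_funM; last exact: measurable_space_kernel_path.
exact: (measurableT_comp mg measurable_snd).
Qed.

End PotentialsAlongPaths.

(** * The increment of N along a path *)

Section PathFormula.
Variable R : realType.
Local Notation mR := (measurableTypeR R).
Variables (d M : nat) (f : 'rV[R]_d -> R) (delta : R).
Local Notation mu := (@lebesgue_tuple R d).
Local Notation rV := (@rV_of_tuple R d).
Local Notation leb := (@lebesgue_measure R).
Local Notation N := (M + d.+1 - 2)%N.
Local Notation lamN := ((d.+1%:R - 2) / 2 : R).
Local Notation lamD := (d.+1%:R / 2 : R).

Hypothesis d2 : (2 <= d)%N.
Hypothesis cf : continuous f.
Hypothesis delta0 : 0 < delta.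
Hypothesis fsupp : forall y, f y != 0 -> delta <= enorm y.
Hypothesis iW : mu.-integrable setT (fun t => (tail_weight f N (rV t))%:E).

Lemma supp_neq0 y : f y != 0 -> y != 0.
Proof. by move=> /fsupp h; rewrite -enorm_gt0 (lt_le_trans delta0). Qed.

Lemma weight_supp_neq0 (w : 'rV[R]_d) y : weight w f y != 0 -> y != 0.
Proof. by rewrite /weight mulf_eq0 negb_or => /andP[_]; exact: supp_neq0. Qed.

Lemma measurable_weight (w : 'rV[R]_d) : measurable_fun setT (fun t => weight w f (rV t)).
Proof.
apply: measurable_funM; first exact: measurable_edot_rV.
exact: measurable_continuous_rV cf.
Qed.

Variables (X : R -> 'rV[R]_d.+1) (a b : R) (w : 'rV[R]_d) (beta gamma : R -> R).
Hypothesis mX : forall j, measurable_fun setT (fun t : mR => X t 0 j).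
Hypothesis cb : forall t : R, {for t, continuous beta}.
Hypothesis cg : forall t : R, {for t, continuous gamma}.
Hypothesis hu : forall (t : R) y,
  is_derive t 1 (fun t => edot (bdry (X t)) y) (beta t * edot w y).
Hypothesis hv : forall t : R, is_derive t 1 (fun t => edot (X t) (X t)) (2 * gamma t).

(** Up to the factor alpha_n x_n these are D_(M-1)[f_w] and D_(M-2)[f] at X t.
The factor x_n is left out because it vanishes on the boundary. *)
Definition fluxD (t : R) : R :=
  integral_Rd (fun y => edot w y * f y * space_kernel M.-1 lamD (X t) y).
Definition fluxR (t : R) : R :=
  integral_Rd (fun y => f y * space_kernel M.-2 lamD (X t) y).

Definition path_formula := opNM M f (X b) =
  oriented_integral a b (fun t => alpha R d.+1 * (beta t * fluxD t)) -
  oriented_integral a b (fun t => alpha R d.+1 * (gamma t * fluxR t)) + opNM M f (X a).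

Local Notation lo := (Num.min a b).
Local Notation hi := (Num.max a b).

Let lamN0 : 0 < lamN.
Proof. by rewrite divr_gt0// subr_gt0 ltr_nat ltnS. Qed.

Let lamNd : 2 * lamN < d%:R.
Proof. by rewrite mulrC divfK// -natr1; lra. Qed.

Let MlamN : M%:R + 2 * lamN = N%:R.
Proof.
rewrite mulrC divfK// addrA -natrD natrB//.
by rewrite (leq_trans _ (leq_addl M _))// ltnW.
Qed.

Let lamN1 : lamN + 1 = lamD.
Proof. by field. Qed.

Lemma measurable_continuous_param (g : R -> R) : (forall t : R, {for t, continuous g}) ->
  measurable_fun setT (g : mR -> R).
Proof. by move=> cg'; apply: continuous_measurable_fun => t; exact: cg'. Qed.

Lemma measurable_kernelD k : measurable_fun setT (fun q : mR * d.-tuple mR =>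
  weight w f (rV q.2) * space_kernel k lamD (X q.1) (rV q.2)).
Proof.
apply: measurable_funM; last exact: measurable_space_kernel_path.
exact: (measurableT_comp (measurable_weight w) measurable_snd).
Qed.

Lemma measurable_kernelR k : measurable_fun setT (fun q : mR * d.-tuple mR =>
  f (rV q.2) * space_kernel k lamD (X q.1) (rV q.2)).
Proof.
apply: measurable_funM; last exact: measurable_space_kernel_path.
exact: (measurableT_comp (measurable_continuous_rV cf) measurable_snd).
Qed.

Lemma measurable_fluxD : measurable_fun setT (fluxD : mR -> R).
Proof.
exact: (@measurable_Rintegral_param _ _
  (fun t y => weight w f y * space_kernel M.-1 lamD (X t) y) (measurable_kernelD _)).
Qed.

Lemma measurable_fluxR : measurable_fun setT (fluxR : mR -> R).
Proof.
exact: (@measurable_Rintegral_param _ _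
  (fun t y => f y * space_kernel M.-2 lamD (X t) y) (measurable_kernelR _)).
Qed.

(** The formula is symmetric in the end points, so it is enough to treat the path in
the direction of increasing parameter. *)
Lemma path_formula_of_integrable :
  {ae mu, forall s, f (rV s) != 0 -> forall t, lo <= t <= hi ->
     0 < enorm (rV s - bdry (X t)) ^+ 2 + lastc (X t) ^+ 2} ->
  (leb \x mu)%E.-integrable setT (fun q => (strip lo hi (fun t y =>
    beta t * (edot w y * f y * space_kernel M.-1 lamD (X t) y)) q)%:E) ->
  (leb \x mu)%E.-integrable setT (fun q => (strip lo hi (fun t y =>
    gamma t * (f y * space_kernel M.-2 lamD (X t) y)) q)%:E) ->
  path_formula.
Proof.
move=> hq H1 H2.
have lohi : lo <= hi by rewrite le_max ge_min lexx.
rewrite -lamN1 in H1 H2.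
have L := line_integral cf delta0 fsupp iW lohi mX lamN0 lamNd MlamN (leqnn _) cb cg hu hv hq H1 H2.
rewrite lamN1 in L.
have mb := measurable_continuous_param cb; have mg := measurable_continuous_param cg.
rewrite /path_formula !oriented_integralZ; last 2 first.
- by apply: measurable_funM => //; exact: measurable_fluxR.
- by apply: measurable_funM => //; exact: measurable_fluxD.
apply/eqP; rewrite -subr_eq; apply/eqP.
rewrite !opNME; try exact: supp_neq0.
rewrite -mulrBr -mulrBr.
have lam2 : 2 * lamN != 0 by rewrite mulf_neq0// gt_eqF.
have e2 : d.+1%:R - 2 = 2 * lamN by rewrite mulrC divfK.
rewrite {1}e2 -mulrA; congr (_ * _).
apply: (mulfI lam2); rewrite mulVKf//.
rewrite /oriented_integral; move: L; have [ab|ba] := leP a b => L.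
  exact: L.
rewrite -opprB L -mulrN; congr (_ * _).
by rewrite opprB addrC opprK.
Qed.

Let lohi : lo <= hi.
Proof. by rewrite le_max ge_min lexx. Qed.

Let lamD0 : 0 <= lamD.
Proof. by rewrite divr_ge0. Qed.

Lemma path_bounded : exists2 rho : R, 0 <= rho &
  forall t, lo <= t <= hi -> enorm (X t) <= rho.
Proof.
have [C C0 h] := continuous_bounded_segment lo hi (fun t => is_derive_continuous (hv t)).
exists (Num.sqrt C); first exact: sqrtr_ge0.
by move=> t /h ht; rewrite ler_wsqrtr// (le_trans (ler_norm _) ht).
Qed.

Definition near_kernel (rho : R) (kappa : R -> 'rV[R]_d -> R) (t : R) (y : 'rV[R]_d) : R :=
  if enorm y <= 2 * rho then `|kappa t y * f y| * space_kernel 0 lamD (X t) y else 0.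

Let kD t y := beta t * edot w y.
Let kR t (y : 'rV[R]_d) := gamma t.

Let mkD : measurable_fun setT (fun q : mR * d.-tuple mR => kD q.1 (rV q.2)).
Proof.
apply: measurable_funM.
  exact: (measurableT_comp (measurable_continuous_param cb) measurable_fst).
exact: (measurableT_comp (measurable_edot_rV w) measurable_snd).
Qed.

Let mkR : measurable_fun setT (fun q : mR * d.-tuple mR => kR q.1 (rV q.2)).
Proof. exact: (measurableT_comp (measurable_continuous_param cg) measurable_fst). Qed.

Let kD_le : exists2 C : R, 0 <= C &
  forall t y, lo <= t <= hi -> `|kD t y| <= C * enorm y ^+ 1.
Proof.
have [C C0 h] := continuous_bounded_segment lo hi cb.
exists (C * enorm w); first by rewrite mulr_ge0// enorm_ge0.
by move=> t y /h ht; rewrite expr1 normrM -mulrA ler_pM//; exact: cauchy_schwarz.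
Qed.

Let kR_le : exists2 C : R, 0 <= C &
  forall t y, lo <= t <= hi -> `|kR t y| <= C * enorm y ^+ 0.
Proof.
have [C C0 h] := continuous_bounded_segment lo hi cg.
by exists C => // t y /h ht; rewrite expr0 mulr1.
Qed.

Lemma path_formula_of_near (rho : R) : 0 <= rho ->
  (forall t, lo <= t <= hi -> enorm (X t) <= rho) ->
  {ae mu, forall s, f (rV s) != 0 -> forall t, lo <= t <= hi ->
     0 < enorm (rV s - bdry (X t)) ^+ 2 + lastc (X t) ^+ 2} ->
  (leb \x mu)%E.-integrable setT (fun q => (strip lo hi (near_kernel rho kD) q)%:E) ->
  (leb \x mu)%E.-integrable setT (fun q => (strip lo hi (near_kernel rho kR) q)%:E) ->
  path_formula.
Proof.
move=> rho0 Xrho hq iD iR.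
have [CD CD0 hD] := kD_le; have [CR CR0 hR] := kR_le.
apply: path_formula_of_integrable => //.
- have Mp : M.-1%:R + 2 * lamD = (M.-1 + d.+1)%:R by rewrite natrD mulrC divfK.
  have Np : (N + 1 <= M.-1 + d.+1)%N by move: d2; clear; case: M => [|m]; lia.
  have := integrable_strip_kernel cf delta0 fsupp iW mX rho0 Xrho lamD0 Mp Np CD0 mkD hD iD.
  congr (_.-integrable _ _); apply/funext => q; congr (strip _ _ _ _)%:E.
  by apply/funext => t; apply/funext => y; rewrite /kD !mulrA.
- have Mp : M.-2%:R + 2 * lamD = (M.-2 + d.+1)%:R by rewrite natrD mulrC divfK.
  have Np : (N + 0 <= M.-2 + d.+1)%N by move: d2; clear; case: M => [|[|m]]; lia.
  have := integrable_strip_kernel cf delta0 fsupp iW mX rho0 Xrho lamD0 Mp Np CR0 mkR hR iR.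
  congr (_.-integrable _ _); apply/funext => q; congr (strip _ _ _ _)%:E.
  by apply/funext => t; apply/funext => y; rewrite /kR !mulrA.
Qed.

Lemma path_formula_separated (c : R) : 0 < c ->
  (forall t y, lo <= t <= hi -> f y != 0 ->
     c <= enorm (y - bdry (X t)) ^+ 2 + lastc (X t) ^+ 2) ->
  path_formula.
Proof.
move=> c0 hc.
have [CD CD0 hD] := kD_le; have [CR CR0 hR] := kR_le.
have [rho rho0 Xrho] := path_bounded.
apply: (path_formula_of_near rho0 Xrho).
- by apply: nearW => s fs t ht; exact: lt_le_trans (hc _ _ ht fs).
- exact: (integrable_near_separated cf iW mX rho0 c0 lamD0 CD0 mkD hD hc).
- exact: (integrable_near_separated cf iW mX rho0 c0 lamD0 CR0 mkR hR hc).
Qed.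

(** With one of beta and gamma zero and the other nonnegative, |y'-y|^2 + x_n^2 is
monotone in t for each y', which gives the second regime. *)
Lemma path_formula_monotone :
  (forall t, lo <= t <= hi -> 0 <= beta t /\ 0 <= gamma t) ->
  (forall t, gamma t = 0) \/ (forall t, beta t = 0) ->
  {ae mu, forall s, forall t, lo <= t <= hi ->
     0 < enorm (rV s - bdry (X t)) ^+ 2 + lastc (X t) ^+ 2} ->
  path_formula.
Proof.
move=> pos flat hq.
have [rho rho0 Xrho] := path_bounded.
have dq (t : R) y : is_derive t 1 (fun t => edot y y - 2 * edot (bdry (X t)) y + edot (X t) (X t))
    (0 - 2 * (beta t * edot w y) + 2 * gamma t).
  exact: (is_derive_fun_add (is_derive_fun_sub (is_derive_cst (edot y y) _ _)
    (is_derive_fun_scale 2 (hu t y))) (hv t)).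
have zero (kappa : R -> 'rV[R]_d -> R) : (forall t y, kappa t y = 0) ->
    (leb \x mu)%E.-integrable setT (fun q => (strip lo hi (near_kernel rho kappa) q)%:E).
  move=> k0; rewrite (_ : (fun _ => _) = cst 0%E); first exact: integrable0.
  apply/funext => q; rewrite /strip; case: ifP => // _.
  by rewrite /near_kernel k0 mul0r normr0 mul0r; case: ifP.
apply: (path_formula_of_near rho0 Xrho).
- by apply: filterS hq => s h _.
- case: flat => [g0|b0]; last by apply: zero => t y; rewrite /kD b0 mul0r.
  rewrite /near_kernel -lamN1.
  apply: (@integrable_near_monotone R d f cf X lo hi rho lohi mX lamN kD (-2)) => //.
  - by move=> t y; apply: (is_derive_eq (dq t y)); rewrite g0 mulr0 addr0 sub0r mulNr.
  - by move=> t y; apply: cvgM; [exact: cb|exact: cvg_cst].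
  - move=> y; have [e0|e0] := leP 0 (edot w y); [left|right] => t /pos[bt _].
      by rewrite /kD mulr_ge0.
    by rewrite /kD mulr_ge0_le0// ltW.
- case: flat => [g0|b0]; first by apply: zero => t y; rewrite /kR g0.
  rewrite /near_kernel -lamN1.
  apply: (@integrable_near_monotone R d f cf X lo hi rho lohi mX lamN kR 2) => //.
  - by move=> t y; apply: (is_derive_eq (dq t y)); rewrite b0 mul0r mulr0 subr0 add0r.
  - by move=> y; left => t /pos[].
Qed.

End PathFormula.

(** * Geometry of the five paths *)

Section Geometry.
Variable R : realType.
Local Notation mR := (measurableTypeR R).
Implicit Types d : nat.

Lemma bdry_hpoint d (y : 'rV[R]_d) t : bdry (hpoint y t) = y.
Proof. by apply/rowP => i; rewrite !mxE liftK. Qed.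

Lemma lastc_hpoint d (y : 'rV[R]_d) t : lastc (hpoint y t) = t.
Proof. by rewrite /lastc mxE unlift_none. Qed.

Lemma hpoint_bdry d (x : 'rV[R]_d.+1) : hpoint (bdry x) (lastc x) = x.
Proof.
by apply/rowP => j; rewrite mxE; case: unliftP => [i ->|->] //=; rewrite mxE.
Qed.

Lemma edot_hpoint d (y : 'rV[R]_d) t : edot (hpoint y t) (hpoint y t) = edot y y + t ^+ 2.
Proof. by rewrite edot_bdry bdry_hpoint lastc_hpoint. Qed.

Lemma edot_unitv d (u : 'rV[R]_d) : u != 0 -> edot (unitv u) (unitv u) = 1.
Proof.
move=> u0; rewrite /unitv edotZl edotZr -sqr_enorm expr2 mulKf ?mulVf//;
  by rewrite enorm_eq0.
Qed.

Lemma enorm_unitv d (u : 'rV[R]_d) : u != 0 -> enorm (unitv u) = 1.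
Proof. by move=> u0; rewrite /enorm edot_unitv// sqrtr1. Qed.

Lemma scale_unitv d (u : 'rV[R]_d) : enorm u *: unitv u = u.
Proof.
have [->|u0] := eqVneq u 0; first by rewrite /unitv !scaler0.
by rewrite /unitv scalerA mulfV ?scale1r// enorm_eq0.
Qed.

Lemma bdryZ d t (x : 'rV[R]_d.+1) : bdry (t *: x) = t *: bdry x.
Proof. by apply/rowP => i; rewrite !mxE. Qed.

Lemma lastcZ d t (x : 'rV[R]_d.+1) : lastc (t *: x) = t * lastc x.
Proof. by rewrite /lastc mxE. Qed.

Lemma set_coordE d (x : 'rV[R]_d) i t : set_coord x i t = x + (t - x 0 i) *: basisv i.
Proof.
apply/rowP => j; rewrite !mxE eqxx /=; case: eqVneq => [->|_].
  by rewrite mulr1 addrC subrK.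
by rewrite mulr0 addr0.
Qed.

Lemma set_coord_id d (x : 'rV[R]_d) i : set_coord x i (x 0 i) = x.
Proof. by rewrite set_coordE subrr scale0r addr0. Qed.

Lemma bdry_set_coord d (x : 'rV[R]_d.+1) i t :
  bdry (set_coord x (lift ord_max i) t) = set_coord (bdry x) i t.
Proof. by apply/rowP => j; rewrite !mxE (inj_eq lift_inj). Qed.

Lemma lastc_set_coord d (x : 'rV[R]_d.+1) i t :
  lastc (set_coord x (lift ord_max i) t) = lastc x.
Proof. by rewrite /lastc mxE (negPf (neq_lift _ _)). Qed.

Lemma set_coord_last d (x : 'rV[R]_d.+1) t : set_coord x ord_max t = hpoint (bdry x) t.
Proof.
apply/rowP => j; rewrite !mxE; case: unliftP => [i ->|->] /=.
  by rewrite eq_sym (negPf (neq_lift _ _)) mxE.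
by rewrite eqxx.
Qed.

Lemma edot_set_coord d (x : 'rV[R]_d) i t :
  edot (set_coord x i t) (set_coord x i t) = edot x x - x 0 i ^+ 2 + t ^+ 2.
Proof.
rewrite set_coordE !(edotDl, edotDr, edotZl, edotZr) (edotC (basisv i)).
rewrite !edot_basis mxE !eqxx /=; ring.
Qed.

Lemma measurable_hpoint_path d (P : R -> 'rV[R]_d) (h : R -> R) :
  (forall i, measurable_fun setT (fun t : mR => P t 0 i)) ->
  measurable_fun setT (h : mR -> R) ->
  forall j, measurable_fun setT (fun t : mR => hpoint (P t) (h t) 0 j).
Proof.
move=> mP mh j; rewrite (_ : (fun _ => _) =
    (fun t => oapp (fun i => P t 0 i) (h t) (unlift ord_max j))); last first.
  by apply/funext => t; rewrite mxE.
by case: unliftP => [i _|_] /=; [exact: mP|exact: mh].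
Qed.

Lemma ae_neq_point d (y0 : 'rV[R]_d) : (0 < d)%N ->
  {ae lebesgue_tuple d, forall s, rV_of_tuple s != y0}.
Proof.
move=> d0; have [A [mA A0 hA]] := ae_coord_neq (fun i => y0 0 i).
exists A; split => // s hs; apply: hA => h; apply: hs; apply/eqP => sy.
by have := h (Ordinal d0); rewrite -sy mxE eqxx.
Qed.

Lemma polar_lt_pihalf d (x : 'rV[R]_d.+1) : 0 < lastc x -> 0 <= polar x < pi / 2.
Proof.
move=> x0; have /andP[p0 ppi] := eangle_ge0 x (basisv ord_max).
rewrite p0/= ltNge; apply/negP => h.
have c0 : 0 < cos (polar x).
  rewrite ltNge; apply/negP => c0; move: x0; rewrite -cos_polar ltNge => /negP; apply.
  by rewrite mulr_ge0_le0// enorm_ge0.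
have pi0 := pi_ge0 R.
have hp : (0 <= pi / 2 :> R) && (pi / 2 <= pi :> R) by apply/andP; split; lra.
move: c0; rewrite ltNge => /negP; apply.
rewrite -(cos_pihalf R) leNgt ltr_cos ?in_itv//= ?p0 ?ppi//.
by rewrite -leNgt.
Qed.

(** A neighbourhood of 0 contains a ball for the sup norm, which contains the
Euclidean ball of the same radius. *)
Lemma closure0_gap d (f : 'rV[R]_d -> R) : ~ closure [set y | f y != 0] 0 ->
  exists2 delta : R, 0 < delta & forall y, f y != 0 -> delta <= enorm y.
Proof.
move=> /existsNP[B /not_implyP[/nbhs_ballP[e /= e0 hB] /set0P/negP]].
rewrite negbK => /eqP fB; exists e => // y fy.
rewrite leNgt; apply/negP => ye.
have : ([set y | f y != 0] `&` B) y.
  split => //; apply: hB; rewrite /ball/= /mx_ball; split => // i j.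
  rewrite (ord1 i) mxE /ball/= sub0r normrN (le_lt_trans _ ye)//.
  exact: coord_le_enorm.
by rewrite fB.
Qed.

End Geometry.

(** * The five formulas *)

Section Cases.
Variable R : realType.
Local Notation mR := (measurableTypeR R).
Variables (d M : nat) (f : 'rV[R]_d -> R) (delta : R).
Local Notation mu := (@lebesgue_tuple R d).
Local Notation rV := (@rV_of_tuple R d).

Hypothesis d2 : (2 <= d)%N.
Hypothesis cf : continuous f.
Hypothesis delta0 : 0 < delta.
Hypothesis fsupp : forall y, f y != 0 -> delta <= enorm y.
Hypothesis iW : mu.-integrable setT (fun t => (tail_weight f (M + d.+1 - 2) (rV t))%:E).

Lemma opD_fluxD (X : R -> 'rV[R]_d.+1) w t :
  opDz (M%:Z - 1) (weight w f) (X t) = alpha R d.+1 * lastc (X t) * fluxD M f X w t.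
Proof.
rewrite (opDzE M 1 _ (weight_supp_neq0 delta0 fsupp (w := w))) subn1.
by [].
Qed.

Lemma opD_fluxR (X : R -> 'rV[R]_d.+1) t :
  opDz (M%:Z - 2) f (X t) = alpha R d.+1 * lastc (X t) * fluxR M f X t.
Proof. by rewrite (opDzE M 2 _ (supp_neq0 delta0 fsupp)) subn2. Qed.

Lemma measurable_opDz1 (X : R -> 'rV[R]_d.+1) w :
  (forall j, measurable_fun setT (fun t : mR => X t 0 j)) ->
  measurable_fun setT (fun t : mR => opDz (M%:Z - 1) (weight w f) (X t)).
Proof.
move=> mX; apply: (measurable_opDz M 1 (weight_supp_neq0 delta0 fsupp (w := w)) _ mX).
exact: measurable_weight.
Qed.

Lemma measurable_opDz2 (X : R -> 'rV[R]_d.+1) :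
  (forall j, measurable_fun setT (fun t : mR => X t 0 j)) ->
  measurable_fun setT (fun t : mR => opDz (M%:Z - 2) f (X t)).
Proof.
move=> mX; apply: (measurable_opDz M 2 (supp_neq0 delta0 fsupp) _ mX).
exact: measurable_continuous_rV.
Qed.

Variable x : 'rV[R]_d.+1.
Hypothesis x0 : 0 < lastc x.

Let xn0 : lastc x != 0. Proof. by rewrite gt_eqF. Qed.

Let xneq0 : x != 0.
Proof.
apply/eqP => x0'; move: x0; rewrite x0' /lastc mxE.
by rewrite ltxx.
Qed.

Lemma continuous_cst_at (c : R) : forall t : R, {for t, continuous (fun=> c : R)}.
Proof. by move=> t; exact: cvg_cst. Qed.
Arguments continuous_cst_at : clear implicits.

Lemma continuous_id_at (t : R) : {for t, continuous (fun s : R => s)}.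
Proof. exact: cvg_id. Qed.

(** At the end point theta0 = pi/2 the path lies on the boundary, where only the
single point y' = x(pi/2) has to be excluded. *)
Lemma polar_angle_formula theta0 : bdry x != 0 -> 0 <= theta0 <= pi / 2 ->
  opNM M f x =
  oriented_integral theta0 (polar x)
    (fun t => opDz (M%:Z - 1) (weight (unitv (bdry x)) f) (set_polar x t))
  + opNM M f (set_polar x theta0).
Proof.
move=> y0 /andP[th0 th1]; have /andP[px0 px1] := polar_lt_pihalf x0.
have xE : set_polar x (polar x) = x.
  by rewrite /set_polar sin_polar cos_polar scale_unitv hpoint_bdry.
have cb (t : R) : {for t, continuous (fun t => enorm x * cos t)}.
  by apply: cvgM; [exact: cvg_cst|exact: continuous_cos].
have cs (t : R) : {for t, continuous (fun t => enorm x * sin t)}.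
  by apply: cvgM; [exact: cvg_cst|exact: continuous_sin].
have mX j : measurable_fun setT (fun t : mR => set_polar x t 0 j).
  apply: measurable_hpoint_path => [i|]; last exact: measurable_continuous_param.
  rewrite (_ : (fun _ => _) = fun t => enorm x * sin t * unitv (bdry x) 0 i); last first.
    by apply/funext => t; rewrite mxE.
  by apply: measurable_funM => //; exact: measurable_continuous_param.
have hu (t : R) y : is_derive t 1 (fun t => edot (bdry (set_polar x t)) y)
    (enorm x * cos t * edot (unitv (bdry x)) y).
  rewrite (_ : (fun t => _) = fun t => enorm x * sin t * edot (unitv (bdry x)) y); last first.
    by apply/funext => s; rewrite bdry_hpoint edotZl.
  apply: (is_derive_eq (is_derive_fun_mul (is_derive_fun_scale (enorm x) (is_derive_sin t))
    (is_derive_cst (edot (unitv (bdry x)) y) _ _))).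
  by rewrite mulr0 addr0.
have hv (t : R) : is_derive t 1 (fun t => edot (set_polar x t) (set_polar x t)) (2 * 0).
  rewrite (_ : (fun t => _) = fun t => enorm x ^+ 2); last first.
    apply/funext => s; rewrite edot_hpoint edotZl edotZr edot_unitv// mulr1 -expr2.
    by rewrite !exprMn -mulrDr sin2cos2 subrK mulr1.
  by rewrite mulr0; exact: is_derive_cst.
have rng t : Num.min theta0 (polar x) <= t <= Num.max theta0 (polar x) -> 0 <= t <= pi / 2.
  move=> /andP[t1 t2]; apply/andP; split.
    by rewrite (le_trans _ t1)// le_min th0 px0.
  by rewrite (le_trans t2)// ge_max th1 ltW.
have P : path_formula M f (set_polar x) theta0 (polar x) (unitv (bdry x))
    (fun t => enorm x * cos t) (fun=> 0).
  apply: (path_formula_monotone d2 cf delta0 fsupp iW mX cb (continuous_cst_at 0) hu hv).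
  - move=> t /rng /andP[t0 t1]; split => //; rewrite mulr_ge0 ?enorm_ge0//.
    by rewrite cos_ge0_pihalf// t1 andbT (le_trans _ t0)// oppr_le0 (le_trans th0).
  - by left.
  - have [A [mA A0 hA]] := ae_neq_point ((enorm x * sin (pi / 2)) *: unitv (bdry x)) (ltnW d2).
    exists A; split => // s hs; apply: hA => h; apply: hs => t /rng /andP[t0 t1].
    rewrite bdry_hpoint lastc_hpoint.
    have [tp|tp] := eqVneq t (pi / 2).
      by rewrite ltr_wpDr ?sqr_ge0// exprn_gt0// enorm_gt0 tp subr_eq0.
    rewrite ltr_wpDl ?sqr_ge0// exprn_gt0// mulr_gt0 ?enorm_gt0//.
    have tlt : t < pi / 2 by rewrite lt_neqAle tp t1.
    rewrite cos_gt0_pihalf// tlt andbT (lt_le_trans _ t0)//.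
    by rewrite oppr_lt0 divr_gt0// pi_gt0.
rewrite -{1}xE P; congr (_ + _).
rewrite [X in _ - X](_ : _ = 0) ?subr0.
  apply: eq_oriented_integral => t _; rewrite opD_fluxD lastc_hpoint; ring.
rewrite -[RHS](oriented_integral0 theta0 (polar x)); apply: eq_oriented_integral => t _.
by rewrite mul0r mulr0.
Qed.

(** Here x_n = t cos theta tends to 0 at the origin, but the angle of the ray with
the boundary is positive, so that |t hatx - y'| >= |y'| cos theta. *)
Lemma radial_formula r0 : bdry x != 0 -> 0 <= r0 ->
  opNM M f x =
  tan (polar x) *
    oriented_integral r0 (enorm x)
      (fun t => opDz (M%:Z - 1) (weight (unitv (bdry x)) f) (t *: unitv x) / t)
  - (cos (polar x))^-1 *
    oriented_integral r0 (enorm x) (fun t => opDz (M%:Z - 2) f (t *: unitv x))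
  + opNM M f (r0 *: unitv x).
Proof.
move=> y0 hr0.
have ex0 : 0 < enorm x by rewrite enorm_gt0.
have exn0 : enorm x != 0 by rewrite gt_eqF.
have sE : sin (polar x) = enorm (bdry x) / enorm x.
  by rewrite -sin_polar mulrC mulKf.
have cE : cos (polar x) = lastc x / enorm x.
  by rewrite -cos_polar mulrC mulKf.
have c0 : 0 < cos (polar x) by rewrite cE divr_gt0.
have cn0 : cos (polar x) != 0 by rewrite gt_eqF.
have bE : bdry (unitv x) = sin (polar x) *: unitv (bdry x).
  by rewrite bdryZ sE mulrC -scalerA scale_unitv.
have lE : lastc (unitv x) = cos (polar x) by rewrite lastcZ cE mulrC.
have mX j : measurable_fun setT (fun t : mR => (t *: unitv x) 0 j).
  rewrite (_ : (fun _ => _) = fun t => t * unitv x 0 j); first exact: measurable_funM.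
  by apply/funext => t; rewrite mxE.
have hu (t : R) y : is_derive t 1 (fun t => edot (bdry (t *: unitv x)) y)
    (sin (polar x) * edot (unitv (bdry x)) y).
  rewrite (_ : (fun t => _) = fun t => t * (sin (polar x) * edot (unitv (bdry x)) y)); last first.
    by apply/funext => s; rewrite bdryZ bE !edotZl.
  apply: (is_derive_eq (is_derive_fun_mul (is_derive_id _ _)
     (is_derive_cst (sin (polar x) * edot (unitv (bdry x)) y) _ _))).
  by rewrite mul1r mulr0 addr0.
have hv (t : R) : is_derive t 1 (fun t => edot (t *: unitv x) (t *: unitv x)) (2 * t).
  rewrite (_ : (fun t => _) = fun t => t * t); last first.
    by apply/funext => s; rewrite edotZl edotZr edot_unitv// mulr1.
  apply: (is_derive_eq (is_derive_fun_mul (is_derive_id _ _) (is_derive_id _ _))).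
  by ring.
have P : path_formula M f (fun t => t *: unitv x) r0 (enorm x) (unitv (bdry x))
    (fun=> sin (polar x)) id.
  apply: (path_formula_separated d2 cf delta0 fsupp iW mX
    (continuous_cst_at _) continuous_id_at hu hv
    (c := (delta * cos (polar x)) ^+ 2)).
  - by rewrite exprn_gt0// mulr_gt0.
  - move=> t y /andP[t0 _] fy.
    have {}t0 : 0 <= t by rewrite (le_trans _ t0)// le_min hr0 enorm_ge0.
    rewrite kernel_base edotZl edotZr edot_unitv// mulr1 bdryZ bE (edotZl t) (edotZl (sin _)) -sqr_enorm.
    have dy := fsupp fy.
    have s0 : 0 <= sin (polar x) by rewrite sE divr_ge0// enorm_ge0.
    have cs : edot (unitv (bdry x)) y <= enorm y.
      by rewrite (le_trans (ler_norm _))// (le_trans (cauchy_schwarz _ _))// enorm_unitv// mul1r.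
    have sc : sin (polar x) ^+ 2 = 1 - cos (polar x) ^+ 2 := sin2cos2 _.
    apply: (@le_trans _ _ ((enorm y * cos (polar x)) ^+ 2)).
      by rewrite lerXn2r ?nnegrE ?mulr_ge0 ?enorm_ge0 ?(ltW c0) ?(ltW delta0)// ler_wpM2r// ltW.
    rewrite -subr_ge0 (_ : _ - _ = (t - enorm y * sin (polar x)) ^+ 2 +
      2 * (t * sin (polar x) * (enorm y - edot (unitv (bdry x)) y))).
      by rewrite addr_ge0 ?sqr_ge0// !mulr_ge0// subr_ge0.
    rewrite sqrrB !exprMn sc; ring.
rewrite -{1}(scale_unitv x) P; congr (_ + _).
have mD := measurable_opDz1 (unitv (bdry x)) mX.
have mR2 := measurable_opDz2 mX.
have mflux : measurable_fun setT (fluxD M f (fun t => t *: unitv x) (unitv (bdry x)) : mR -> R).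
  exact: measurable_fluxD.
have gE (t : R) : t != 0 ->
   opDz (M%:Z - 1) (weight (unitv (bdry x)) f) (t *: unitv x) / t =
   alpha R d.+1 * cos (polar x) * fluxD M f (fun t => t *: unitv x) (unitv (bdry x)) t.
  by move=> t0; rewrite (opD_fluxD (fun t => t *: unitv x)) lastcZ lE; field.
have mdiv : measurable_fun setT (fun t : mR =>
    opDz (M%:Z - 1) (weight (unitv (bdry x)) f) (t *: unitv x) / t).
  rewrite (_ : (fun _ => _) = fun t => if t == 0 then 0 else
     alpha R d.+1 * cos (polar x) * fluxD M f (fun t => t *: unitv x) (unitv (bdry x)) t).
    apply: measurable_fun_ifT => //; first exact: measurable_fun_eqr.
    exact: measurable_funM.
  by apply/funext => t; case: eqVneq => [->|/gE//]; rewrite invr0 mulr0.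
rewrite -!oriented_integralZ//.
congr (_ - _); last first.
  apply: eq_oriented_integral => t _; rewrite (opD_fluxR (fun t => t *: unitv x)) lastcZ lE.
  by field.
apply: (@ae_eq_oriented_integral _ _ _ 0).
- by apply: measurable_funM => //; exact: measurable_funM.
- exact: measurable_funM.
by move=> t t0; rewrite gE// /tan; field.
Qed.

(** If x_n is constant along the path, the kernel is bounded by x_n^(-n), and the
factor x_n of D is divided out. *)
Lemma horizontal_formula (X : R -> 'rV[R]_d.+1) (w : 'rV[R]_d) (a b : R) :
  (forall j, measurable_fun setT (fun t : mR => X t 0 j)) ->
  (forall t, lastc (X t) = lastc x) ->
  (forall (t : R) y, is_derive t 1 (fun t => edot (bdry (X t)) y) (edot w y)) ->
  (forall t : R, is_derive t 1 (fun t => edot (X t) (X t)) (2 * t)) ->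
  X b = x ->
  opNM M f x =
  (lastc x)^-1 * oriented_integral a b (fun t => opDz (M%:Z - 1) (weight w f) (X t))
  - (lastc x)^-1 * oriented_integral a b (fun t => opDz (M%:Z - 2) f (X t) * t)
  + opNM M f (X a).
Proof.
move=> mX Xn hu hv Xb.
have hu' (t : R) y : is_derive t 1 (fun t => edot (bdry (X t)) y) (1 * edot w y).
  by rewrite mul1r.
have P : path_formula M f X a b w (fun=> 1) id.
  apply: (path_formula_separated d2 cf delta0 fsupp iW mX
    (continuous_cst_at 1) continuous_id_at hu' hv (c := lastc x ^+ 2)).
    by rewrite exprn_gt0.
  by move=> t y _ _; rewrite Xn lerDr sqr_ge0.
rewrite -[in LHS]Xb P; congr (_ + _).
have mD := measurable_opDz1 w mX.
have mR2 := measurable_opDz2 mX.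
rewrite -!oriented_integralZ//; last exact: measurable_funM.
congr (_ - _); apply: eq_oriented_integral => t _.
  by rewrite opD_fluxD Xn; field.
by rewrite opD_fluxR Xn; field.
Qed.

Lemma coordinate_formula (i : 'I_d) ti :
  opNM M f x =
  (lastc x)^-1 * oriented_integral ti (bdry x 0 i)
    (fun t => opDz (M%:Z - 1) (weight (basisv i) f) (set_coord x (lift ord_max i) t))
  - (lastc x)^-1 * oriented_integral ti (bdry x 0 i)
    (fun t => opDz (M%:Z - 2) f (set_coord x (lift ord_max i) t) * t)
  + opNM M f (set_coord x (lift ord_max i) ti).
Proof.
apply: (horizontal_formula (X := set_coord x (lift ord_max i))).
- move=> j; rewrite (_ : (fun _ => _) = fun t => if j == lift ord_max i then t else x 0 j).
    by case: (j == lift ord_max i).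
  by apply/funext => t; rewrite mxE.
- by move=> t; rewrite lastc_set_coord.
- move=> t y.
  rewrite (_ : (fun t => _) =
    fun t => edot (bdry x) y + (t - bdry x 0 i) * edot (basisv i) y); last first.
    by apply/funext => s; rewrite bdry_set_coord set_coordE edotDl edotZl.
  apply: (is_derive_eq (is_derive_fun_add (is_derive_cst (edot (bdry x) y) _ _)
    (is_derive_fun_mul (is_derive_fun_sub (is_derive_id _ _) (is_derive_cst (bdry x 0 i) _ _))
      (is_derive_cst (edot (basisv i) y) _ _)))).
  by rewrite add0r subr0 mul1r mulr0 addr0.
- move=> t.
  rewrite (_ : (fun t => _) = fun t => edot x x - x 0 (lift ord_max i) ^+ 2 + t * t); last first.
    by apply/funext => s; rewrite edot_set_coord expr2.
  apply: (is_derive_eq (is_derive_fun_add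
    (is_derive_cst (edot x x - x 0 (lift ord_max i) ^+ 2) _ _)
    (is_derive_fun_mul (is_derive_id _ _) (is_derive_id _ _)))).
  by ring.
- by rewrite mxE set_coord_id.
Qed.

Lemma boundary_radial_formula rho : bdry x != 0 ->
  opNM M f x =
  (lastc x)^-1 * oriented_integral rho (enorm (bdry x))
    (fun t => opDz (M%:Z - 1) (weight (unitv (bdry x)) f) (hpoint (t *: unitv (bdry x)) (lastc x)))
  - (lastc x)^-1 * oriented_integral rho (enorm (bdry x))
    (fun t => opDz (M%:Z - 2) f (hpoint (t *: unitv (bdry x)) (lastc x)) * t)
  + opNM M f (hpoint (rho *: unitv (bdry x)) (lastc x)).
Proof.
move=> y0.
apply: (horizontal_formula (X := fun t => hpoint (t *: unitv (bdry x)) (lastc x))).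
- apply: measurable_hpoint_path => // i.
  rewrite (_ : (fun _ => _) = fun t => t * unitv (bdry x) 0 i); first exact: measurable_funM.
  by apply/funext => t; rewrite mxE.
- by move=> t; rewrite lastc_hpoint.
- move=> t y.
  rewrite (_ : (fun t => _) = fun t => t * edot (unitv (bdry x)) y); last first.
    by apply/funext => s; rewrite bdry_hpoint edotZl.
  apply: (is_derive_eq (is_derive_fun_mul (is_derive_id _ _)
    (is_derive_cst (edot (unitv (bdry x)) y) _ _))).
  by rewrite mul1r mulr0 addr0.
- move=> t.
  rewrite (_ : (fun t => _) = fun t => t * t + lastc x ^+ 2); last first.
    by apply/funext => s; rewrite edot_hpoint edotZl edotZr edot_unitv// mulr1.
  apply: (is_derive_eq (is_derive_fun_add
    (is_derive_fun_mul (is_derive_id _ _) (is_derive_id _ _))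
    (is_derive_cst (lastc x ^+ 2) _ _))).
  by ring.
- by rewrite scale_unitv hpoint_bdry.
Qed.

(** The path has beta = 0 and may start on the boundary. *)
Lemma vertical_formula tn : 0 <= tn ->
  opNM M f x =
  - oriented_integral tn (lastc x) (fun t => opDz (M%:Z - 2) f (set_coord x ord_max t))
  + opNM M f (set_coord x ord_max tn).
Proof.
move=> tn0.
have E : set_coord x ord_max = hpoint (bdry x).
  by apply/funext => t; rewrite set_coord_last.
rewrite E.
have mX j : measurable_fun setT (fun t : mR => hpoint (bdry x) t 0 j).
  exact: (measurable_hpoint_path (P := fun=> bdry x)).
have hu (t : R) y : is_derive t 1 (fun t => edot (bdry (hpoint (bdry x) t)) y)
    (0 * edot (0 : 'rV[R]_d) y).
  rewrite (_ : (fun t => _) = fun t => edot (bdry x) y) ?mul0r; first exact: is_derive_cst.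
  by apply/funext => s; rewrite bdry_hpoint.
have hv (t : R) : is_derive t 1 (fun t => edot (hpoint (bdry x) t) (hpoint (bdry x) t)) (2 * t).
  rewrite (_ : (fun t => _) = fun t => edot (bdry x) (bdry x) + t * t); last first.
    by apply/funext => s; rewrite edot_hpoint.
  apply: (is_derive_eq (is_derive_fun_add (is_derive_cst (edot (bdry x) (bdry x)) _ _)
    (is_derive_fun_mul (is_derive_id _ _) (is_derive_id _ _)))).
  by ring.
have rng t : Num.min tn (lastc x) <= t -> 0 <= t.
  by move=> t1; rewrite (le_trans _ t1)// le_min tn0 ltW.
have P : path_formula M f (hpoint (bdry x)) tn (lastc x) 0 (fun=> 0) id.
  apply: (path_formula_monotone d2 cf delta0 fsupp iW mX
    (continuous_cst_at 0) continuous_id_at hu hv).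
  - by move=> t /andP[/rng t0 _].
  - by right.
  - have [A [mA A0 hA]] := ae_neq_point (bdry x) (ltnW d2).
    exists A; split => // s hs; apply: hA => h; apply: hs => t /andP[/rng t0 _].
    by rewrite bdry_hpoint ltr_wpDr ?sqr_ge0// exprn_gt0// enorm_gt0 subr_eq0.
rewrite -{1}(hpoint_bdry x) P; congr (_ + _).
rewrite [X in X - _](_ : _ = 0) ?sub0r.
  congr (- _); apply: eq_oriented_integral => t _.
  by rewrite opD_fluxR lastc_hpoint mulrA.
rewrite -[RHS](oriented_integral0 tn (lastc x)); apply: eq_oriented_integral => t _.
by rewrite mul0r mulr0.
Qed.

End Cases.

Theorem proposition3p2 (R : realType) (n M : nat) (f : 'rV[R]_n.-1 -> R)
    (x : 'rV[R]_n.-1.+1) :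
  (3 <= n)%N ->
  continuous f ->
  ~ closure [set y' | f y' != 0] 0 ->
  (\int[lebesgue_tuple n.-1]_t
     (`|f (rV_of_tuple t)| / (enorm (rV_of_tuple t) ^+ (M + n - 2) + 1))%:E
     < +oo)%E ->
  0 < lastc x ->
  let y := bdry x in
  let theta := polar x in
  let xn := lastc x in
  let haty := unitv y in
  [/\ forall theta0 : R, y != 0 -> 0 <= theta0 <= pi / 2 ->
        opNM M f x =
        oriented_integral theta0 theta
          (fun t => opDz (M%:Z - 1) (weight haty f) (set_polar x t))
        + opNM M f (set_polar x theta0),
      forall r0 : R, y != 0 -> 0 <= r0 ->
        opNM M f x =
        tan theta *
          oriented_integral r0 (enorm x)
            (fun t => opDz (M%:Z - 1) (weight haty f) (t *: unitv x) / t)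
        - (cos theta)^-1 *
          oriented_integral r0 (enorm x)
            (fun t => opDz (M%:Z - 2) f (t *: unitv x))
        + opNM M f (r0 *: unitv x),
      forall (i : 'I_n.-1) (ti : R),
        let xi t := set_coord x (lift ord_max i) t in
        opNM M f x =
        xn^-1 *
          oriented_integral ti (y 0 i)
            (fun t => opDz (M%:Z - 1) (weight (basisv i) f) (xi t))
        - xn^-1 *
          oriented_integral ti (y 0 i)
            (fun t => opDz (M%:Z - 2) f (xi t) * t)
        + opNM M f (xi ti),
      forall rho : R, y != 0 -> 0 <= rho ->
        let xr t := hpoint (t *: haty) xn in
        opNM M f x =
        xn^-1 *
          oriented_integral rho (enorm y)
            (fun t => opDz (M%:Z - 1) (weight haty f) (xr t))
        - xn^-1 *
          oriented_integral rho (enorm y)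
            (fun t => opDz (M%:Z - 2) f (xr t) * t)
        + opNM M f (xr rho)
    & forall tn : R, 0 <= tn ->
        let xt t := set_coord x ord_max t in
        opNM M f x =
        - oriented_integral tn xn (fun t => opDz (M%:Z - 2) f (xt t))
        + opNM M f (xt tn)].
Proof.
case: n f x => // d f x d2 cf /closure0_gap[delta delta0 fsupp] W x0 /=.
have iW : (lebesgue_tuple d).-integrable setT
    (fun t => (tail_weight f (M + d.+1 - 2) (rV_of_tuple t))%:E).
  apply/integrableP; split.
    apply/measurable_EFinP; apply: measurable_funM.
      apply: measurableT_comp; first exact: normr_measurable.
      exact: (measurable_continuous_rV cf).
    rewrite (_ : (fun _ => _) = fun t => (enorm (rV_of_tuple t) ^+ (M + d.+1 - 2) + 1) `^ (-1)).
      apply: (measurableT_comp (measurable_powR _)); apply: measurable_funD => //.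
      apply: measurable_funX; apply: measurable_enorm; exact: measurable_coord_rV.
    apply/funext => t; rewrite powR_inv1//.
    by rewrite addr_ge0// exprn_ge0// enorm_ge0.
  under eq_integral do rewrite gee0_abs ?lee_fin ?tail_weight_ge0//.
  exact: W.
split.
- exact: (polar_angle_formula d2 cf delta0 fsupp iW x0).
- exact: (radial_formula d2 cf delta0 fsupp iW x0).
- exact: (coordinate_formula d2 cf delta0 fsupp iW x0).
- by move=> rho y0 _; exact: (boundary_radial_formula d2 cf delta0 fsupp iW x0).
- exact: (vertical_formula d2 cf delta0 fsupp iW x0).
Qed.
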